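(* Let $(\cdot,\cdot)_*$ be an inner product on $V_h$ with induced norm $\|\cdot\|_*$, and consider, for $\tau>0$ and $u_h^0\in\mathcal{A}_h$, the constrained curvature flow iteration: for $k=1,2,\dots$ compute $d_tu_h^k\in\mathcal{F}_h[u_h^{k-1}]$ such that $$(d_tu_h^k,v_h)_*+([u_h^{k-1}+\tau d_tu_h^k]'',v_h'')=0\quad\text{for all }v_h\in\mathcal{F}_h[u_h^{k-1}],$$ and set $u_h^k=u_h^{k-1}+\tau d_tu_h^k$. Let $I[u]=\frac12\int_0^L|u''|^2\,dx$ and $e_{0,h}=I[u_h^0]$. (i) The iteration defines a sequence $(u_h^k)_{k=0,1,\dots}\subset V_h$ such that for every $K\ge0$ $$I[u_h^K]+\tau\sum_{k=1}^K\|d_tu_h^k\|_*^2\le I[u_h^0]=e_{0,h}.$$ (ii) Assume that $$\|v_h'\|_{L_h^\infty(0,L)}^2\le c_*\|v_h\|_*^2\quad\text{for all }v_h\in V_h,$$ and that $|\Phi_S''(s)|\le c_{S,2}(1+|s|^r)$ for all $s\in\mathbb{R}^3$, with constants $c_*,c_{S,2}>0$ and $r\ge0$. Then there is a constant $c'>0$, independent of $\tau$ and $K$, such that for every $K\ge0$ $$\max_{k=0,\dots,K}\big\||[u_h^k]'|^2-1\big\|_{L_h^\infty(0,L)}\le c_*\tau e_{0,h}$$ and $$\max_{k=0,\dots,K}\|\Phi_S(u_h^k)\|_{L_h^\infty(0,L)}\le c_*c_{S,2}c'\tau e_{0,h}^{r+1}.$$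
   Context: Let $L>0$; $(\cdot,\cdot)$ is the $L^2(0,L;\mathbb{R}^3)$ inner product. $\Phi_S\in C^1(\mathbb{R}^3)$ (and $\Phi_S\in C^2(\mathbb{R}^3)$ for part (ii)) defines the surface $S=\{\Phi_S=0\}$; $\Phi_S'$, $\Phi_S''$ denote its gradient and Hessian. $L_{\rm bc}:H^2(0,L;\mathbb{R}^3)\to\mathbb{R}^\ell$ is a bounded linear operator, $\ell_{\rm bc}\in\mathbb{R}^\ell$; it is assumed that $v\mapsto\|v''\|_{L^2(0,L)}$ is a norm on the kernel of $L_{\rm bc}$. For a partition $0=z_0<\dots<z_J=L$, $V_h$ is the space of all $v_h\in C^1([0,L];\mathbb{R}^3)$ that are componentwise polynomials of degree at most $3$ on each $[z_{j-1},z_j]$. For continuous $v$, $\|v\|_{L_h^\infty(0,L)}=\max_{j=0,\dots,J}|v(z_j)|$. The discrete admissible set and the discrete linearized admissible space at $\widehat u_h\in V_h$ are $$\mathcal{A}_h=\{v_h\in V_h:|v_h'(z_j)|=1,\ \Phi_S(v_h(z_j))=0,\ j=0,\dots,J,\ L_{\rm bc}[v_h]=\ell_{\rm bc}\},$$ $$\mathcal{F}_h[\widehat u_h]=\{v_h\in V_h:\Phi_S'(\widehat u_h(z_j))\cdot v_h(z_j)=0,\ \widehat u_h'(z_j)\cdot v_h'(z_j)=0,\ j=0,\dots,J,\ L_{\rm bc}[v_h]=0\}.$$ *)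

(* Defs.v *)
From mathcomp Require Import all_boot all_order all_algebra.
From mathcomp Require Import all_classical all_reals all_analysis.

Set Implicit Arguments.
Unset Strict Implicit.
Unset Printing Implicit Defensive.

Import Order.TTheory GRing.Theory Num.Theory.
Import numFieldNormedType.Exports.

Local Open Scope classical_set_scope.
Local Open Scope ring_scope.

(* Functions on [0, L] are represented by functions on the whole line; their
   values off [0, L] are irrelevant.  Equality of such functions is [eq_on]. *)
Notation curve R := (R -> 'rV[R]_3).

Section Euclidean.
Variable R : realType.

Definition dot n (x y : 'rV[R]_n) : R := \sum_(i < n) x 0 i * y 0 i.

(* The library's norm on matrices is the maximum norm. *)
Definition enorm n (x : 'rV[R]_n) : R := Num.sqrt (dot x x).

Definition frobenius n (A : 'M[R]_n) : R :=
  Num.sqrt (\sum_(i < n) \sum_(j < n) A i j ^+ 2).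

Definition partial n (f : 'rV[R]_n -> R^o) (i : 'I_n) : 'rV[R]_n -> R^o :=
  fun x => 'D_(delta_mx 0 i) f x.

Definition gradient n (f : 'rV[R]_n -> R^o) (x : 'rV[R]_n) : 'rV[R]_n :=
  \row_i partial f i x.

Definition hessian n (f : 'rV[R]_n -> R^o) (x : 'rV[R]_n) : 'M[R]_n :=
  \matrix_(i, j) partial (partial f i) j x.

Definition C1 n (f : 'rV[R]_n -> R^o) : Prop :=
  (forall x, differentiable f x) /\ (forall i, continuous (partial f i)).

Definition C2 n (f : 'rV[R]_n -> R^o) : Prop :=
  C1 f /\ (forall i, C1 (partial f i)).

End Euclidean.

Section Sobolev.
Variables (R : realType) (L : R).
Implicit Types (f g phi : R -> R) (v w : curve R).

Let mu := @lebesgue_measure R.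

Definition eq_on v w : Prop := forall x, x \in `[0, L] -> v x = w x.

Definition component v (i : 'I_3) : R -> R := fun x => v x 0 i.

Definition L2_prod v w : R :=
  \int[mu]_(x in `]0, L[) dot (v x) (w x).

Definition L2_norm v : R := Num.sqrt (L2_prod v v).

Definition square_integrable f : Prop :=
  measurable_fun `]0, L[ f /\
  mu.-integrable `]0, L[ (fun x => (f x ^+ 2)%:E).

Definition test_function phi : Prop :=
  (forall n x, derivable (derive1n n (phi : R -> R^o)) x 1) /\
  (exists a b : R, [/\ 0 < a, b < L &
     forall x, x \notin `[a, b] -> phi x = 0]).

(* [g] is the [k]-th weak derivative of [f] on (0, L). *)
Definition weak_derivative (k : nat) f g : Prop :=
  forall phi, test_function phi ->
    \int[mu]_(x in `]0, L[) (f x * derive1n k (phi : R -> R^o) x) =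
    (-1) ^+ k * \int[mu]_(x in `]0, L[) (g x * phi x).

(* [v] belongs to H^2(0, L; R^3), with weak derivatives [v1] and [v2]. *)
Definition H2_with v v1 v2 : Prop :=
  forall i : 'I_3,
    [/\ square_integrable (component v i),
        square_integrable (component v1 i) /\
          weak_derivative 1 (component v i) (component v1 i) &
        square_integrable (component v2 i) /\
          weak_derivative 2 (component v i) (component v2 i)].

Definition H2 v : Prop := exists v1 v2, H2_with v v1 v2.

(* The bound forces [B] to vanish on functions that vanish a.e. on (0, L), so
   [B] is an operator on the a.e. classes. *)
Definition bounded_linear_H2 (ell : nat) (B : curve R -> 'rV[R]_ell) : Prop :=
  (forall (a : R) v w, H2 v -> H2 w -> B (a *: v + w) = a *: B v + B w) /\
  (exists C : R, forall v v1 v2, H2_with v v1 v2 ->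
     enorm (B v) <=
     C * Num.sqrt (L2_norm v ^+ 2 + L2_norm v1 ^+ 2 + L2_norm v2 ^+ 2)).

(* v |-> ||v''|| is a seminorm on H^2, so it is a norm on the kernel of [B] as
   soon as it is definite there. *)
Definition D2_norm_on_kernel (ell : nat) (B : curve R -> 'rV[R]_ell) : Prop :=
  forall v v1 v2, H2_with v v1 v2 -> B v = 0 -> L2_norm v2 = 0 ->
    {ae mu, forall x, x \in `]0, L[ -> v x = 0}.

End Sobolev.

Section Discrete.
Variables (R : realType) (L : R) (J : nat) (z : nat -> R).
Variables (Phi : 'rV[R]_3 -> R^o).
Variables (ell : nat) (Lbc : curve R -> 'rV[R]_ell) (lbc : 'rV[R]_ell).
Implicit Types (u v w : curve R).

(* Only z 0, ..., z J matter. *)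
Definition is_partition : Prop :=
  [/\ z 0%N = 0, z J = L & forall j, (j < J)%N -> z j < z j.+1].

(* A function in C^1([0, L]) is represented by an extension that is also
   differentiable at 0 and L, so that its one-sided derivatives there are given
   by [derive1]. *)
Definition C1_interval v : Prop :=
  (forall x, x \in `[0, L] -> derivable v x 1) /\
  {within `[0, L], continuous (derive1 v)}.

Definition Vh v : Prop :=
  C1_interval v /\
  (forall j, (j < J)%N -> forall i : 'I_3,
     exists2 p : {poly R}, (size p <= 4)%N &
       forall x, x \in `[z j, z j.+1] -> v x 0 i = p.[x]).

(* For [v] in [Vh], the second derivative exists in (0, L) off the nodes. *)
Definition D2 v : curve R := derive1n 2 v.

Definition bending v : R := 2^-1 * L2_norm L (D2 v) ^+ 2.

Definition Linf_h (f : R -> R) : R :=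
  \big[Num.max/0]_(j < J.+1) `|f (z j)|.

Definition Ah v : Prop :=
  [/\ Vh v,
      forall j, (j <= J)%N -> enorm (derive1 v (z j)) = 1,
      forall j, (j <= J)%N -> Phi (v (z j)) = 0 &
      Lbc v = lbc].

Definition Fh u v : Prop :=
  [/\ Vh v,
      forall j, (j <= J)%N -> dot (gradient Phi (u (z j))) (v (z j)) = 0,
      forall j, (j <= J)%N -> dot (derive1 u (z j)) (derive1 v (z j)) = 0 &
      Lbc v = 0].

(* Inner product on V_h modulo [eq_on]. The direction from right to left of the
   last clause makes [ip] compatible with [eq_on], by Cauchy-Schwarz. *)
Definition inner_product_Vh (ip : curve R -> curve R -> R) : Prop :=
  [/\ forall (a : R) u v w, Vh u -> Vh v -> Vh w ->
        ip (a *: u + v) w = a * ip u w + ip v w,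
      forall v w, Vh v -> Vh w -> ip v w = ip w v,
      forall v, Vh v -> 0 <= ip v v &
      forall v, Vh v -> (ip v v = 0 <-> eq_on L v 0)].

Definition ip_norm (ip : curve R -> curve R -> R) v : R := Num.sqrt (ip v v).

(* [d k] is d_t u_h^k for k >= 1; [d 0] is unused. *)
Definition curvature_flow (ip : curve R -> curve R -> R) (tau : R)
    (u0 : curve R) (u d : nat -> curve R) : Prop :=
  u 0%N = u0 /\
  forall k : nat,
    [/\ Fh (u k) (d k.+1),
        forall v, Fh (u k) v ->
          ip (d k.+1) v + L2_prod L (D2 (u k + tau *: d k.+1)) (D2 v) = 0 &
        u k.+1 = u k + tau *: d k.+1].

End Discrete.

(* Main.v *)
Require Import Defs.
From HB Require Import structures.
From mathcomp Require Import all_boot all_order all_algebra.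
From mathcomp Require Import all_classical all_reals all_analysis.
From mathcomp Require Import measurable_realfun ring lra.

Set Implicit Arguments.
Unset Strict Implicit.
Unset Printing Implicit Defensive.

Import Order.TTheory GRing.Theory Num.Theory.
Import numFieldNormedType.Exports.

Local Open Scope classical_set_scope.
Local Open Scope ring_scope.

(** The discrete problem lives in a finite-dimensional space: an element of
    [Vh] is determined, as a function on [0, L], by four samples on every
    subinterval. Write [B v w] for the integral of the product of the second
    derivatives. One step of the flow asks for [d] in the subspace [Fh u] with
      ip d v + tau * B d v = - B u v   for all v in Fh u,
    and the form on the left is positive definite modulo equality on [0, L];
    hence the step is a Riesz representation problem ([form_Riesz],
    [flow_step]), and uniqueness follows by testing the difference of two
    solutions with itself ([flow_unique]).

    Energy law: testing the step with [d] itself and using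
      2 tau B (u + tau d) d
        = B (u + tau d) (u + tau d) - B u u + tau ^ 2 B d d
    gives [step_energy]; summing over the steps gives [flow_energy].

    Constraint violation: each constraint is satisfied to first order along
    the step, because [d] is tangent to it at [u], so a step only adds a
    second-order error. For the length constraint the error is exactly
    tau ^ 2 |d'(z_j)| ^ 2 ([flow_node_derive1]). For the constraint
    [Phi = 0], Taylor's formula bounds it by the Hessian of [Phi] between the
    old and the new nodal value times tau ^ 2 |d(z_j)| ^ 2
    ([flow_node_value]). Nodal derivatives of [d] are bounded by its norm
    ||d|| for the inner product [ip] by assumption, nodal values because all
    norms on a finite-dimensional space are equivalent ([node_bound]). So in
    both cases the sum over the steps is at most a constant times
    tau * (tau * \sum ||d_k|| ^ 2), and the energy law bounds the bracket by
    the initial energy, which leaves one factor tau.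

    The Hessian is controlled once the nodal values stay in a fixed ball. This
    is where the assumption on the boundary operator enters: [u_k - u_0] lies
    in the kernel of [Lbc], on which [B] is definite, so its nodal values are
    bounded by its bending energy, again by [form_Riesz] and the
    Cauchy-Schwarz inequality ([form_bounded], [flow_bounded]). To apply the
    assumption, which speaks of H^2 functions, one needs that splines in [Vh]
    have weak derivatives given by their piecewise ones; this is integration
    by parts on every subinterval, where the boundary terms telescope because
    the function is continuous ([pw_by_parts], [Vh_H2_with]). *)

(** * Semidefinite forms with finitely many separating functionals *)

Section SemidefiniteForm.
Variables (R : rcfType) (T : lmodType R) (P : T -> Prop) (a : T -> T -> R).
Hypothesis P0 : P 0.
Hypothesis PZD : forall c u v, P u -> P v -> P (c *: u + v).
Hypothesis aZD : forall c u v w, P u -> P v -> P w ->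
  a (c *: u + v) w = c * a u w + a v w.
Hypothesis a_sym : forall u v, P u -> P v -> a u v = a v u.
Hypothesis a_ge0 : forall u, P u -> 0 <= a u u.

Let linear_on (l : T -> R) :=
  forall c u v, P u -> P v -> l (c *: u + v) = c * l u + l v.

Lemma linear_on0 l : linear_on l -> l 0 = 0.
Proof.
move=> hl; have := hl 1 0 0 P0 P0.
by rewrite scale1r addr0 mul1r => /eqP; rewrite -subr_eq subrr eq_sym => /eqP.
Qed.

Lemma closed_sum m (c : 'I_m -> R) (b : 'I_m -> T) :
  (forall i, P (b i)) -> P (\sum_i c i *: b i).
Proof.
move=> hb; elim/big_rec: _ => // i x _ Px; exact: PZD.
Qed.

Lemma linear_on_sum l m (c : 'I_m -> R) (b : 'I_m -> T) : linear_on l ->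
  (forall i, P (b i)) -> l (\sum_i c i *: b i) = \sum_i c i * l (b i).
Proof.
move=> hl hb.
suff [] : P (\sum_i c i *: b i) /\
  l (\sum_i c i *: b i) = \sum_i c i * l (b i) by [].
elim/big_rec2: _ => [|i x y _ [Py <-]]; first by rewrite linear_on0.
by split; [exact: PZD | rewrite hl].
Qed.

Lemma linear_on_formr w : P w -> linear_on (a ^~ w).
Proof. by move=> Pw c u v Pu Pv; exact: aZD. Qed.

Lemma linear_on_forml w : P w -> linear_on (a w).
Proof.
move=> Pw c u v Pu Pv; rewrite a_sym//; last exact: PZD.
by rewrite aZD// (a_sym Pu)// (a_sym Pv).
Qed.

Lemma form_sqrZD c u v : P u -> P v ->
  a (c *: u + v) (c *: u + v) = c ^+ 2 * a u u + 2 * c * a u v + a v v.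
Proof.
move=> Pu Pv; rewrite aZD//; last exact: PZD.
rewrite !linear_on_forml// (a_sym Pv Pu).
ring.
Qed.

(** For a form that is only semidefinite the case [a u u = 0] is separate: there
    [a (c *: u + v) (c *: u + v)] is affine in [c] and nonnegative, so its slope
    vanishes. *)
Lemma form_CauchySchwarz u v : P u -> P v -> a u v ^+ 2 <= a u u * a v v.
Proof.
move=> Pu Pv; have pos c := a_ge0 (PZD c Pu Pv).
have [u0|u0] := eqVneq (a u u) 0.
  suff -> : a u v = 0 by rewrite u0 mul0r expr0n.
  apply/eqP; apply/negPn/negP => uv0.
  (* at this c the affine function takes the value -1 *)
  have := pos (- (a v v + 1) / (2 * a u v)).
  rewrite form_sqrZD// u0 mulr0 add0r.
  suff -> : 2 * (- (a v v + 1) / (2 * a u v)) * a u v = - (a v v + 1) by lra.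
  by field; rewrite uv0.
have u_gt0 : 0 < a u u by rewrite lt_def u0 a_ge0.
have := pos (- a u v / a u u); rewrite form_sqrZD//.
have -> : (- a u v / a u u) ^+ 2 * a u u + 2 * (- a u v / a u u) * a u v + a v v
  = (a u u * a v v - a u v ^+ 2) / a u u by field.
by rewrite pmulr_lge0 ?invr_gt0// subr_ge0.
Qed.

Variables (I : finType) (ev : I -> T -> R).
Hypothesis ev_lin : forall i, linear_on (ev i).
Hypothesis ev_null : forall v, P v -> (forall i, ev i v = 0) -> a v v = 0.

Let orthonormal m (b : 'I_m -> T) :=
  (forall i, P (b i)) /\ forall i j, a (b i) (b j) = (i == j)%:R.

(** The functionals [ev] separate the points of [P] modulo the null vectors of
    [a], so they embed an orthonormal family as linearly independent rows: this
    is the only way in which finite dimension enters. *)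
Lemma orthonormal_size m (b : 'I_m -> T) : orthonormal b -> (m <= #|I|)%N.
Proof.
move=> [Pb bb].
pose M : 'M[R]_(m, #|I|) := \matrix_(i, k) ev (enum_val k) (b i).
suff : row_free M by move/eqP <-; exact: rank_leq_col.
rewrite -kermx_eq0; apply/eqP/row_matrixP => r; rewrite row0.
set c := row r _.
have cM : c *m M = 0 by apply/sub_kermxP/row_sub.
have evc i : ev i (\sum_k c 0 k *: b k) = 0.
  rewrite linear_on_sum//.
  move/rowP/(_ (enum_rank i)): cM; rewrite [LHS]mxE [RHS]mxE => cM0.
  rewrite -[RHS]cM0.
  apply: eq_bigr => k _.
  by rewrite [M k _]mxE enum_rankK.
have := ev_null (closed_sum _ Pb) evc.
rewrite (linear_on_sum _ (linear_on_formr (closed_sum _ Pb)) Pb).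
rewrite (eq_bigr (fun k => c 0 k ^+ 2)) => [|k _]; last first.
  rewrite (linear_on_sum _ (linear_on_forml (Pb k)) Pb).
  rewrite (bigD1 k)//= big1 => [|j jk]; last by rewrite bb eq_sym (negbTE jk) mulr0.
  by rewrite bb eqxx mulr1 addr0 -expr2.
move=> /eqP; rewrite psumr_eq0 => [/allP c0|k _]; last exact: sqr_ge0.
apply/rowP => k; have := c0 k; rewrite mem_index_enum => /(_ isT) /=.
by rewrite sqrf_eq0 => /eqP ->; rewrite mxE.
Qed.

(** In an orthonormal family of maximal size, a vector of [P] minus its
    projection must be null; otherwise, normalized, it would extend the family. *)
Lemma orthonormal_complete : exists m (b : 'I_m -> T), orthonormal b /\
  forall v, P v ->
    let w := v - \sum_i a v (b i) *: b i in P w /\ a w w = 0.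
Proof.
pose Q m := `[< exists b : 'I_m -> T, orthonormal b >].
have Q0 : exists m, Q m.
  by exists 0%N; apply/asboolP; exists (fun=> 0); split=> -[].
have Qle m : Q m -> (m <= #|I|)%N.
  by move=> /asboolP[b]; exact: orthonormal_size.
case: (ex_maxnP Q0 Qle) => m /asboolP[b bo] max.
exists m, b; split=> // v Pv; case: bo => Pb bb.
set w := _ - _.
have wE : w = (-1) *: (\sum_i a v (b i) *: b i) + v.
  by rewrite scaleN1r addrC.
have Pw : P w by rewrite wE; apply: PZD => //; exact: closed_sum.
split=> //.
have wb j : a w (b j) = 0.
  rewrite wE aZD//; last exact: closed_sum.
  rewrite (linear_on_sum _ (linear_on_formr (Pb j)) Pb).
  rewrite (bigD1 j)//= big1 => [|i ij]; last by rewrite bb (negbTE ij) mulr0.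
  by rewrite bb eqxx mulr1 addr0 mulN1r addNr.
apply/eqP; apply/negPn/negP => w0.
have w_gt0 : 0 < a w w by rewrite lt_def w0 a_ge0.
pose e := (Num.sqrt (a w w))^-1 *: w.
have Ze k : P k -> a e k = (Num.sqrt (a w w))^-1 * a w k.
  move=> Pk; have := aZD (Num.sqrt (a w w))^-1 Pw P0 Pk; rewrite addr0 => ->.
  by rewrite (linear_on0 (linear_on_formr Pk)) addr0.
have Pe : P e by rewrite /e -[_ *: _]addr0; exact: PZD.
have ee : a e e = 1.
  rewrite Ze// a_sym// Ze// mulrA -expr2 exprVn sqr_sqrtr; last exact: ltW.
  by rewrite mulVf.
pose b' (i : 'I_m.+1) := if unlift ord_max i is Some j then b j else e.
suff /max : Q m.+1 by rewrite ltnn.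
apply/asboolP; exists b'; split=> [i|i j].
  by rewrite /b'; case: unliftP.
rewrite /b'; case: (unliftP ord_max i) => [i'|] ->;
  case: (unliftP ord_max j) => [j'|] ->.
- by rewrite (inj_eq lift_inj) bb.
- by rewrite a_sym// Ze// wb mulr0 eq_sym (negbTE (neq_lift _ _)).
- by rewrite Ze// wb mulr0 (negbTE (neq_lift _ _)).
- by rewrite eqxx.
Qed.

(** Expanding along a complete orthonormal family, [d] has the coordinates
    [l (b i)]. Vectors are compared modulo null vectors only, which spares the
    quotient of a space of curves by equality on [0, L]. *)
Lemma form_Riesz (l : T -> R) : linear_on l ->
  (forall v, P v -> a v v = 0 -> l v = 0) ->
  exists2 d, P d & forall v, P v -> a d v = l v.
Proof.
move=> hl l0; have [m [b [[Pb bb] bE]]] := orthonormal_complete.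
exists (\sum_i l (b i) *: b i); first exact: closed_sum.
move=> v Pv; rewrite (linear_on_sum _ (linear_on_formr Pv) Pb).
have [Pw w0] := bE v Pv; have := l0 _ Pw w0.
rewrite -[_ - _](@addrC _ (- _)) -scaleN1r hl//; last exact: closed_sum.
rewrite linear_on_sum// mulN1r addrC => /eqP; rewrite subr_eq0 => /eqP ->.
by apply: eq_bigr => i _; rewrite (a_sym Pv)// mulrC.
Qed.

(** A functional that vanishes on null vectors is bounded: Cauchy-Schwarz
    applied to its representative. With [a] a norm this is the equivalence of
    norms in finite dimension, in the form in which it is used for nodal
    values. *)
Lemma form_bounded (l : T -> R) : linear_on l ->
  (forall v, P v -> a v v = 0 -> l v = 0) ->
  exists2 C, 0 <= C & forall v, P v -> `|l v| <= C * Num.sqrt (a v v).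
Proof.
move=> hl l0; have [d Pd dE] := form_Riesz hl l0.
exists (Num.sqrt (a d d)) => [|v Pv]; first exact: sqrtr_ge0.
rewrite -dE// -sqrtr_sqr -sqrtrM ?a_ge0//.
by rewrite ler_sqrt ?mulr_ge0 ?a_ge0// form_CauchySchwarz.
Qed.

End SemidefiniteForm.

(** * Integrals of piecewise continuous functions *)

Lemma integrableU d (T : measurableType d) (R : realType)
    (mu : {measure set T -> \bar R}) (A B : set T) (f : T -> \bar R) : measurable A ->
  measurable B -> [disjoint A & B] ->
  mu.-integrable A f -> mu.-integrable B f -> mu.-integrable (A `|` B) f.
Proof.
move=> mA mB AB /integrableP[fA iA] /integrableP[fB iB]; apply/integrableP.
have mAB : measurable_fun (A `|` B) f by apply/measurable_funU.
split=> //; rewrite ge0_integral_setU//=; first by rewrite lte_add_pinfty.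
exact: measurableT_comp.
Qed.

Section PiecewiseContinuous.
Variables (R : realType) (J : nat) (z : nat -> R).
Implicit Types f g : R -> R.
Hypothesis z_lt : forall j, (j < J)%N -> z j < z j.+1.

Let mu := @lebesgue_measure R.

(** The nodes are left out, since second derivatives of splines are not
    controlled there; the continuous [g] on the whole line provides finite
    one-sided limits. *)
Definition pw_continuous f := forall j, (j < J)%N ->
  exists2 g, continuous g & {in `]z j, z j.+1[, f =1 g}.

Lemma continuous_pw f : continuous f -> pw_continuous f.
Proof. by move=> cf j _; exists f. Qed.

Lemma pw_continuousD f g : pw_continuous f -> pw_continuous g ->
  pw_continuous (fun x => f x + g x).
Proof.
move=> pf pg j jJ; have [f1 cf1 ff1] := pf j jJ; have [g1 cg1 gg1] := pg j jJ.
exists (fun x => f1 x + g1 x) => [x|x xj].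
  by apply: cvgD; [exact: cf1 | exact: cg1].
by rewrite ff1// gg1.
Qed.

Lemma pw_continuousM f g : pw_continuous f -> pw_continuous g ->
  pw_continuous (fun x => f x * g x).
Proof.
move=> pf pg j jJ; have [f1 cf1 ff1] := pf j jJ; have [g1 cg1 gg1] := pg j jJ.
exists (fun x => f1 x * g1 x) => [x|x xj].
  by apply: cvgM; [exact: cf1 | exact: cg1].
by rewrite ff1// gg1.
Qed.

Lemma pw_continuous_sum (I : Type) (r : seq I) (F : I -> R -> R) :
  (forall i, pw_continuous (F i)) ->
  pw_continuous (fun x => \sum_(i <- r) F i x).
Proof.
move=> pF; elim: r => [|i r IH].
  under eq_fun do rewrite big_nil.
  by apply: continuous_pw => x; exact: cvg_cst.
by under eq_fun do rewrite big_cons; exact: pw_continuousD.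
Qed.

Lemma z_le i j : (i <= j)%N -> (j <= J)%N -> z i <= z j.
Proof.
elim: j => [|j IH]; first by rewrite leqn0 => /eqP ->.
rewrite leq_eqVlt => /predU1P[->//|ij jJ].
by rewrite (le_trans (IH ij (ltnW jJ)))// ltW// z_lt.
Qed.

Lemma continuous_integrable_cc f a b : continuous f ->
  mu.-integrable `[a, b] (EFin \o f).
Proof.
move=> cf; apply: continuous_compact_integrable; first exact: segment_compact.
exact: continuous_subspaceT.
Qed.

Lemma integrable_set1 (f : R -> R) r : mu.-integrable [set r] (EFin \o f).
Proof.
apply/integrableP; split; first exact: measurable_fun_set1.
by rewrite integral_set1// ltey.
Qed.

Lemma pw_integrable_oo f j : pw_continuous f -> (j < J)%N ->
  mu.-integrable `]z j, z j.+1[ (EFin \o f).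
Proof.
move=> pf /pf[g cg fg].
have : mu.-integrable `]z j, z j.+1[ (EFin \o g).
  apply: integrableS (continuous_integrable_cc _ _ cg) => //.
  exact: subset_itv_oo_cc.
by apply: eq_integrable => // x /set_mem/= xj; rewrite /= fg.
Qed.

Lemma pw_integrable_oc f j : pw_continuous f -> (j < J)%N ->
  mu.-integrable `]z j, z j.+1] (EFin \o f).
Proof.
move=> pf jJ; rewrite -(setUitv1 true); last by rewrite bnd_simp z_lt.
apply: integrableU => //.
- apply/disj_setPS => x [/=]; rewrite in_itv/= => /andP[_ +] xE.
  by rewrite xE ltxx.
- exact: pw_integrable_oo.
- exact: integrable_set1.
Qed.

Let oc_split j : (j < J)%N ->
  `]z 0%N, z j.+1]%classic = `]z 0%N, z j] `|` `]z j, z j.+1].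
Proof.
move=> jJ; rewrite (@itv_bndbnd_setU _ _ _ (BRight (z j)))// bnd_simp.
  by rewrite z_le// ltnW.
by rewrite ltW// z_lt.
Qed.

Let oc_disj j : [disjoint `]z 0%N, z j] & `]z j, z j.+1]].
Proof.
apply/disj_setPS => x [/=]; rewrite !in_itv/= => /andP[_ xj] /andP[jx _].
by move: xj; rewrite leNgt jx.
Qed.

Let pw_integrable_n f n : pw_continuous f -> (n <= J)%N ->
  mu.-integrable `]z 0%N, z n] (EFin \o f).
Proof.
move=> pf; elim: n => [_|n IH nJ].
  rewrite set_itv_ge ?bnd_simp ?ltxx//. exact: integrable_set0.
rewrite oc_split//; apply: integrableU => //; first exact: IH (ltnW nJ).
exact: pw_integrable_oc.
Qed.

Lemma pw_integrable f : pw_continuous f ->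
  mu.-integrable `]z 0%N, z J[ (EFin \o f).
Proof.
move=> pf; apply: integrableS (pw_integrable_n pf (leqnn J)) => //.
by apply: subset_itvl; rewrite bnd_simp.
Qed.

Lemma pw_integral f : pw_continuous f ->
  \int[mu]_(x in `]z 0%N, z J[) f x =
  \sum_(j < J) \int[mu]_(x in `]z j, z j.+1[) f x.
Proof.
move=> pf; rewrite Rintegral_itv_bndo_bndc; last exact: pw_integrable.
suff : forall n, (n <= J)%N -> \int[mu]_(x in `]z 0%N, z n]) f x =
  \sum_(j < n) \int[mu]_(x in `]z j, z j.+1[) f x by exact.
elim=> [_|n IH nJ]; first by rewrite set_itv_ge ?bnd_simp ?ltxx// Rintegral_set0 big_ord0.
rewrite oc_split// Rintegral_setU//; last first.
  by rewrite -oc_split//; exact: pw_integrable_n.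
rewrite IH; last exact: ltnW.
rewrite big_ord_recr/= -Rintegral_itv_bndo_bndc//.
exact: pw_integrable_oo.
Qed.

Lemma pw_eq_integral f g : pw_continuous f -> 
  (forall j, (j < J)%N -> {in `]z j, z j.+1[, f =1 g}) ->
  \int[mu]_(x in `]z 0%N, z J[) f x = \int[mu]_(x in `]z 0%N, z J[) g x.
Proof.
move=> pf fg.
have pg : pw_continuous g.
  move=> j jJ; have [h ch fh] := pf j jJ; exists h => // x xj.
  by rewrite -(fg j)// fh.
rewrite !pw_integral//; apply: eq_bigr => j _; apply: eq_Rintegral => x.
by move=> /set_mem/=; exact: (fg _ (ltn_ord j)).
Qed.

End PiecewiseContinuous.

(** * Weak derivatives of piecewise polynomials *)

Section OneSided.
Variable R : realType.

(** Two functions that agree on one side of a point have the same one-sided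
    difference quotients there. This identifies derivatives at nodes and at the
    endpoints 0 and L, where no full neighbourhood is available. *)
Lemma eq_derive1_segment (f g : R -> R) (a b x : R) : a < b ->
  {in `[a, b], f =1 g} -> x \in `[a, b] ->
  derivable f x 1 -> derivable g x 1 -> derive1 f x = derive1 g x.
Proof.
move=> ab fg xab df dg; rewrite !derive1E /derive.
have [xb|bx] := ltP x b.
  have quotient : \forall t \near 0^'+,
      t^-1 *: ((f \o shift x) (t *: 1) - f x) =
      t^-1 *: ((g \o shift x) (t *: 1) - g x).
    near=> t; rewrite /= !fg//.
    have t0 : 0 < t by [].
    have tb : t < b - x by near: t; apply: nbhs_right_lt; rewrite subr_gt0.
    move: xab; rewrite !in_itv/= -[_ *: _]/(t * 1) mulr1 => /andP[ax _].
    apply/andP; split; lra.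
  rewrite (cvg_at_rightE _ _ df) (cvg_at_rightE _ _ dg).
  by apply: congr1; apply/seteqP; split; apply: near_eq_cvg => //; near do apply/esym.
have xE : x = b.
  by apply/eqP; rewrite eq_le bx andbT; move: xab; rewrite in_itv/= => /andP[].
have quotient : \forall t \near 0^'-,
    t^-1 *: ((f \o shift x) (t *: 1) - f x) =
    t^-1 *: ((g \o shift x) (t *: 1) - g x).
  near=> t; rewrite /= !fg//.
  have t0 : t < 0 by [].
  have tb : a - b < t by near: t; apply: nbhs_left_gt; rewrite subr_lt0.
  rewrite !in_itv/= xE -[_ *: _]/(t * 1) mulr1.
  apply/andP; split; lra.
rewrite (cvg_at_leftE _ _ df) (cvg_at_leftE _ _ dg).
by apply: congr1; apply/seteqP; split; apply: near_eq_cvg => //; near do apply/esym.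
Unshelve. all: by end_near. Qed.

Lemma derive1_coord n (v : R -> 'rV[R]_n) x i : derivable v x 1 ->
  derive1 v x 0 i = derive1 (fun y => v y 0 i) x.
Proof. by move=> dv; rewrite !derive1E derive_mx// mxE. Qed.

Lemma derivable_coord n (v : R -> 'rV[R]_n) x i : derivable v x 1 ->
  derivable (fun y => v y 0 i) x 1.
Proof. by move/derivable_mxP. Qed.

End OneSided.

Section WeakDerivative.
Variables (R : realType) (J : nat) (z : nat -> R).
Hypothesis z_lt : forall j, (j < J)%N -> z j < z j.+1.

Let mu := @lebesgue_measure R.
Let L := z J.
Hypothesis z0 : z 0%N = 0.

(** [f] is required to be polynomial on the closed subintervals, hence
    continuous, whereas [g] may jump at the nodes: thus the definition applies
    both to a spline with its derivative and to the latter with the second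
    derivative. *)
Definition pw_primitive (f g : R -> R) := forall j, (j < J)%N ->
  exists p : {poly R}, {in `[z j, z j.+1], f =1 horner p} /\
    {in `]z j, z j.+1[, g =1 horner p^`()}.

Lemma pw_primitive_continuous f g : pw_primitive f g ->
  pw_continuous J z f /\ pw_continuous J z g.
Proof.
move=> fg; split=> j jJ; have [p [fp gp]] := fg j jJ.
  exists (horner p); first exact: continuous_horner.
  by move=> x xj; rewrite fp//; exact: subset_itv_oo_cc.
by exists (horner p^`()) => //; exact: continuous_horner.
Qed.

Lemma Rintegral_oo_cc (f : R -> R) a b : mu.-integrable `[a, b] (EFin \o f) ->
  \int[mu]_(x in `]a, b[) f x = \int[mu]_(x in `[a, b]) f x.
Proof.
move=> fi; rewrite Rintegral_itv_bndo_bndc.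
  rewrite Rintegral_itv_obnd_cbnd//; apply: integrableS fi => //.
  by apply: subset_itvr; rewrite bnd_simp.
by apply: integrableS fi => //; exact: subset_itv_oo_cc.
Qed.

Lemma derivable_LRcontinuous (f : R -> R) a b :
  (forall x, derivable f x 1) -> derivable_oo_LRcontinuous f a b.
Proof.
move=> df; have cf x : {for x, continuous f}.
  exact/differentiable_continuous/derivable1_diffP.
split=> [x _//||].
  by apply: cvg_at_right_filter; exact: cf.
by apply: cvg_at_left_filter; exact: cf.
Qed.

(** On every subinterval [f] is a polynomial, so the usual formula applies; the
    boundary terms telescope because [f] is continuous at the nodes, and the
    remaining two vanish with [phi]. *)
Lemma pw_by_parts f g (phi : R -> R) : pw_primitive f g ->
  (forall x, derivable phi x 1) -> continuous (derive1 phi) ->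
  phi 0 = 0 -> phi L = 0 ->
  \int[mu]_(x in `]0, L[) (f x * derive1 phi x) =
  - \int[mu]_(x in `]0, L[) (g x * phi x).
Proof.
move=> fg dphi cdphi phi0 phiL.
have cphi : continuous phi.
  by move=> x; exact/differentiable_continuous/derivable1_diffP.
have [pf pg] := pw_primitive_continuous fg.
rewrite -z0 /L !pw_integral//; last 2 first.
- by apply: pw_continuousM => //; exact: continuous_pw.
- by apply: pw_continuousM => //; exact: continuous_pw.
have part (j : 'I_J) :
    \int[mu]_(x in `]z j, z j.+1[) (f x * derive1 phi x) =
    (f (z j.+1) * phi (z j.+1) - f (z j) * phi (z j)) -
    \int[mu]_(x in `]z j, z j.+1[) (g x * phi x).
  have [p [fp gp]] := fg j (ltn_ord j); have jlt := z_lt (ltn_ord j).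
  have fl : f (z j) = p.[z j] by rewrite fp// in_itv/= lexx ltW.
  have fr : f (z j.+1) = p.[z j.+1] by rewrite fp// in_itv/= lexx ltW.
  rewrite fl fr.
  transitivity (\int[mu]_(x in `]z j, z j.+1[) (p.[x] * derive1 phi x)).
    apply: eq_Rintegral => x /set_mem/= xj; rewrite fp//.
    exact: subset_itv_oo_cc.
  transitivity ((p.[z j.+1] * phi (z j.+1) - p.[z j] * phi (z j)) -
    \int[mu]_(x in `]z j, z j.+1[) ((p^`()).[x] * phi x)); last first.
    by congr (_ - _); apply: eq_Rintegral => x /set_mem/= xj; rewrite gp.
  rewrite !Rintegral_oo_cc.
  - apply: (@Rintegration_by_parts _ (horner p) phi (horner p^`()) (derive1 phi) _ _ jlt).
    + exact/continuous_subspaceT/continuous_horner.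
    + by apply: derivable_LRcontinuous => x; exact: derivable_horner.
    + by move=> x _; rewrite derivE.
    + exact: continuous_subspaceT.
    + exact: derivable_LRcontinuous.
    + by [].
  - apply: continuous_integrable_cc => x.
    by apply: cvgM; [exact: continuous_horner | exact: cphi].
  - apply: continuous_integrable_cc => x.
    by apply: cvgM; [exact: continuous_horner | exact: cdphi].
under eq_bigr => j _ do rewrite part.
rewrite sumrB.
rewrite -(big_mkord xpredT
  (fun j => f (z j.+1) * phi (z j.+1) - f (z j) * phi (z j))).
rewrite telescope_sumr// z0 phi0 [phi (z J)]phiL !mulr0 subrr.
exact: sub0r.
Qed.

Lemma test_function0 phi (x : R) : test_function L phi -> x \notin `]0, L[ ->
  phi x = 0.
Proof.
move=> [_ [a [b [a0 bL phi0]]]] x0L; apply: phi0; apply: contra x0L.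
rewrite !in_itv/= => /andP[ax xb].
by rewrite (lt_le_trans a0 ax) (le_lt_trans xb bL).
Qed.

Lemma test_function_derive1 phi : test_function L phi ->
  test_function L (derive1 phi).
Proof.
move=> [dphi [a [b [a0 bL phi0]]]]; split=> [n x|].
  by rewrite -derive1Sn; exact: dphi.
exists a, b; split=> // x xab.
rewrite derive1E (@near_eq_derive _ _ _ _ (cst 0)) ?derive_cst//.
move: xab; rewrite in_itv/= negb_and -!ltNge => /orP[xa|bx]; near=> y;
  rewrite phi0// in_itv/= negb_and -!ltNge; apply/orP.
- by left; near: y; exact: lt_nbhsl.
- by right; near: y; exact: lt_nbhsr.
Unshelve. all: by end_near. Qed.

Lemma pw_primitive_weak f g : pw_primitive f g -> weak_derivative L 1 f g.
Proof.
move=> fg phi tphi; have [dphi _] := tphi; rewrite expr1 mulN1r.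
apply: pw_by_parts => //.
- exact: (dphi 0%N).
- by move=> x; apply/differentiable_continuous/derivable1_diffP; exact: (dphi 1%N).
- by apply: test_function0 => //; rewrite in_itv/= ltxx.
- by apply: test_function0 => //; rewrite in_itv/= ltxx andbF.
Qed.

(** The derivative of a test function is a test function. *)
Lemma weak_derivative_comp f g h : weak_derivative L 1 f g ->
  weak_derivative L 1 g h -> weak_derivative L 2 f h.
Proof.
move=> fg gh phi tphi.
have := fg _ (test_function_derive1 tphi); rewrite -derive1Sn => ->.
by rewrite (gh _ tphi) mulrA -exprD.
Qed.

Lemma pw_square_integrable f : pw_continuous J z f ->
  square_integrable L f.
Proof.
move=> pf; rewrite /L /square_integrable -z0; split.
  by apply/measurable_EFinP; apply: (measurable_int mu); exact: pw_integrable.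
apply: (pw_integrable z_lt); under eq_fun do rewrite expr2.
exact: pw_continuousM.
Qed.

End WeakDerivative.

(** * Euclidean vectors and Taylor's formula *)

Section Dot.
Variables (R : realType) (n : nat).
Implicit Types u v w : 'rV[R]_n.

Lemma dotC u v : dot u v = dot v u.
Proof. by apply: eq_bigr => i _; rewrite mulrC. Qed.

Lemma dotZD c u v w : dot (c *: u + v) w = c * dot u w + dot v w.
Proof.
rewrite /dot mulr_sumr -big_split; apply: eq_bigr => i _ /=.
by rewrite !mxE mulrDl mulrA.
Qed.

Lemma dot0l u : dot 0 u = 0.
Proof. by rewrite /dot big1// => i _; rewrite mxE mul0r. Qed.

Lemma dot_ge0 u : 0 <= dot u u.
Proof. by apply: sumr_ge0 => i _; rewrite -expr2 sqr_ge0. Qed.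

Lemma enorm_sqr u : enorm u ^+ 2 = dot u u.
Proof. by rewrite sqr_sqrtr// dot_ge0. Qed.

Lemma enorm_ge0 u : 0 <= enorm u. Proof. exact: sqrtr_ge0. Qed.

Lemma sqr_enormZ_orth c u v : dot u v = 0 ->
  enorm (u + c *: v) ^+ 2 = enorm u ^+ 2 + c ^+ 2 * enorm v ^+ 2.
Proof.
move=> uv; rewrite !enorm_sqr addrC dotZD [dot v _]dotC [dot u (_ + _)]dotC !dotZD.
by rewrite (dotC v u) uv; ring.
Qed.

Lemma enorm_le_sum u : enorm u <= \sum_i `|u 0 i|.
Proof.
have s_ge0 : 0 <= \sum_i `|u 0 i| by exact: sumr_ge0.
rewrite -(ger0_norm s_ge0) -sqrtr_sqr ler_sqrt ?sqr_ge0//.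
rewrite expr2 mulr_suml; apply: ler_sum => i _.
rewrite -expr2 -real_normK ?num_real// expr2 ler_wpM2l//.
by rewrite (bigD1 i)//= lerDl sumr_ge0.
Qed.

End Dot.

Section Taylor.
Variables (R : realType) (n : nat).
Implicit Types (f : 'rV[R]_n -> R^o) (x h : 'rV[R]_n).

Lemma derive_gradient f x h : differentiable f x ->
  'D_h f x = dot (gradient f x) h.
Proof.
move=> df; rewrite deriveE// {1}(row_sum_delta h) linear_sum.
apply: eq_bigr => i _; rewrite linearZ mxE /partial deriveE// mulrC.
by [].
Qed.

(** Both difference quotients are the same function of the increment. *)
Lemma is_derive_line f x h (s : R) : differentiable f (x + s *: h) ->
  is_derive s (1 : R) (fun t : R => f (x + t *: h)) ('D_h f (x + s *: h)).
Proof.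
move=> df.
have quotient : (fun t : R => t^-1 *: (((fun t : R => f (x + t *: h)) \o shift s) (t *: 1)
    - f (x + s *: h))) =
  (fun t : R => t^-1 *: ((f \o shift (x + s *: h)) (t *: h) - f (x + s *: h))).
  apply/funext => t /=; congr (_ *: (f _ - _)).
  by rewrite -[t *: 1]/(t * 1) mulr1 scalerDl addrCA.
have fd : derivable f (x + s *: h) h by exact: diff_derivable.
by apply: DeriveDef; rewrite /derivable /derive quotient.
Qed.

Lemma entry_le_frobenius (A : 'M[R]_n) i j : `|A i j| <= frobenius A.
Proof.
have ge0 k l : 0 <= A k l ^+ 2 by exact: sqr_ge0.
rewrite -sqrtr_sqr ler_sqrt; last by apply: sumr_ge0 => k _; exact: sumr_ge0.
rewrite (bigD1 i)//= (bigD1 j)//= -addrA lerDl addr_ge0 ?sumr_ge0// => k _.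
exact: sumr_ge0.
Qed.

(** The mean value theorem is applied twice to the restriction of [f] to the
    segment: to the function, at [t], and to its derivative on [0, t]. The
    crude bound of the quadratic form by the sum of the absolute values avoids
    an operator norm and is harmless, since only the order in [h] matters. *)
Lemma Taylor1_bound f x h (M : R) : C2 f ->
  (forall s : R, s \in `[0, 1] -> frobenius (hessian f (x + s *: h)) <= M) ->
  `|f (x + h) - f x - dot (gradient f x) h| <= M * (\sum_i `|h 0 i|) ^+ 2.
Proof.
move=> [[df _] C1f] hM.
pose g (t : R) : R := f (x + t *: h).
pose G (t : R) : R := dot (gradient f (x + t *: h)) h.
pose H (t : R) : R := \sum_i \sum_j h 0 i * h 0 j * hessian f (x + t *: h) i j.
have dg s : is_derive s (1 : R) g (G s).
  by rewrite /G -derive_gradient//; exact: is_derive_line.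
have dG s : is_derive s (1 : R) G (H s).
  have GE : G = (\sum_i (h 0 i *: (fun t : R => partial f i (x + t *: h)))).
    apply/funext => t; rewrite fct_sumE; apply: eq_bigr => i _.
    by rewrite mxE mulrC.
  have -> : H s = \sum_i h 0 i *: 'D_h (partial f i) (x + s *: h).
    apply: eq_bigr => i _; have [dfi _] := C1f i.
    rewrite derive_gradient// /dot scaler_sumr; apply: eq_bigr => j _.
    by rewrite !mxE -mulrA [in LHS](mulrC (h 0 j)).
  rewrite GE; apply: is_derive_sum => i; apply: is_deriveZ.
  by have [dfi _] := C1f i; exact: is_derive_line.
have cont (k k' : R -> R) (dk : forall s, is_derive s (1 : R) k (k' s)) a b :
    {within `[a, b], continuous k}.
  apply: continuous_subspaceT => s.
  by apply/differentiable_continuous/derivable1_diffP; have [] := dk s.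
have [t t01 gE] := MVT ltr01 (fun s _ => dg s) (cont _ _ dg 0 1).
have [t0 t1] : 0 < t /\ t < 1 by move: t01; rewrite in_itv/= => /andP[].
have [s s0t GE] := MVT t0 (fun s _ => dG s) (cont _ _ dG 0 t).
have [s0 st] : 0 < s /\ s < t by move: s0t; rewrite in_itv/= => /andP[].
have -> : f (x + h) - f x - dot (gradient f x) h = H s * t.
  rewrite -[t in RHS]subr0 -GE /G scale0r addr0; congr (_ - _).
  by move: gE; rewrite /g scale1r scale0r addr0 subr0 mulr1.
rewrite normrM (ger0_norm (ltW t0)) (le_trans _ (_ : `|H s| <= _))//.
  by rewrite ler_piMr// ltW.
rewrite expr2 mulr_suml mulr_sumr (le_trans (ler_norm_sum _ _ _))//.
apply: ler_sum => i _; rewrite mulr_sumr mulr_sumr.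
rewrite (le_trans (ler_norm_sum _ _ _))//; apply: ler_sum => j _.
rewrite !normrM mulrC ler_wpM2r// ?mulr_ge0//.
apply: le_trans (entry_le_frobenius _ _ _) (hM _ _).
by rewrite in_itv/= !ltW// (lt_trans st).
Qed.

End Taylor.

(** * The spline space *)

Section PolynomialCurve.
Variable R : realType.

Definition poly_curve n (q : 'I_n -> {poly R}) (x : R) : 'rV[R]_n :=
  \row_i (q i).[x].

Lemma derive1_poly_curve n (q : 'I_n -> {poly R}) x :
  derive1 (poly_curve q) x = poly_curve (fun i => (q i)^`()) x.
Proof.
have coordE i : (fun y => poly_curve q y 0 i) = horner (q i).
  by apply/funext => y; rewrite mxE.
have dq : derivable (poly_curve q) x 1.
  by apply/derivable_mxP => r i; rewrite (ord1 r) coordE; exact: derivable_horner.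
by apply/rowP => i; rewrite derive1_coord// coordE mxE derivE.
Qed.

(** Differentiating at interior points only, this can be iterated without any
    regularity assumption on [v]. *)
Lemma derive1_eq_poly n (v : R -> 'rV[R]_n) q a b :
  {in `]a, b[, v =1 poly_curve q} ->
  {in `]a, b[, derive1 v =1 poly_curve (fun i => (q i)^`())}.
Proof.
move=> vq x xab; rewrite -derive1_poly_curve !derive1E; apply: near_eq_derive.
near=> y; apply: vq; near: y; exact: near_in_itvoo.
Unshelve. all: by end_near. Qed.

Lemma D2_eq_poly (v : curve R) q a b :
  {in `]a, b[, v =1 poly_curve q} ->
  {in `]a, b[, D2 v =1 poly_curve (fun i => (q i)^`()^`())}.
Proof. by move=> /derive1_eq_poly/derive1_eq_poly. Qed.

Lemma poly_curveZD n c (p q : 'I_n -> {poly R}) x :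
  poly_curve (fun i => c *: p i + q i) x = c *: poly_curve p x + poly_curve q x.
Proof. by apply/rowP => i; rewrite !mxE hornerD hornerZ. Qed.

End PolynomialCurve.

(** Locked, because comparing two of these terms by conversion would unfold the
    Lebesgue integral. *)
HB.lock Definition bend (R : realType) (L : R) (v w : curve R) : R :=
  L2_prod L (D2 v) (D2 w).

Lemma bend_L2_prod (R : realType) (L : R) (v w : curve R) :
  bend L v w = L2_prod L (D2 v) (D2 w).
Proof. by rewrite unlock. Qed.

Section SplineSpace.
Variables (R : realType) (L : R) (J : nat) (z : nat -> R).
Hypothesis L_gt0 : 0 < L.
Hypothesis hz : is_partition L J z.
Implicit Types u v w : curve R.

Let z_lt j : (j < J)%N -> z j < z j.+1. Proof. by case: hz => _ _; exact. Qed.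
Let z0 : z 0%N = 0. Proof. by case: hz. Qed.
Let zJ : z J = L. Proof. by case: hz. Qed.

Local Notation V := (Vh L J z).

Lemma piece_sub j x : (j < J)%N -> x \in `[z j, z j.+1] -> x \in `[0, L].
Proof.
move=> jJ; rewrite !in_itv/= -z0 -zJ => /andP[zx xz].
rewrite (le_trans _ zx) ?(z_le z_lt)//=; last exact: ltnW.
by rewrite (le_trans xz)// (z_le z_lt).
Qed.

Lemma piece_exists x : x \in `[0, L] ->
  exists2 j, (j < J)%N & x \in `[z j, z j.+1].
Proof.
rewrite in_itv/= -z0 -zJ => /andP[x0 xJ].
have J_gt0 : (0 < J)%N.
  by case: J zJ => // ; rewrite z0 => L0; move: L_gt0; rewrite -L0 ltxx.
suff : forall n, (0 < n)%N -> (n <= J)%N -> x <= z n ->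
  exists2 j, (j < J)%N & x \in `[z j, z j.+1] by move/(_ J J_gt0 (leqnn J) xJ).
elim=> // n IH _ nJ xn; have [xz|zx] := leP x (z n); last first.
  by exists n => //; rewrite in_itv/= xn ltW.
case: n IH nJ xn xz => [|n] IH nJ xn xz; last exact: (IH _ (ltnW nJ) xz).
by exists 0%N => //; rewrite in_itv/= x0.
Qed.

Lemma node_in j : (j <= J)%N -> z j \in `[0, L].
Proof. by move=> jJ; rewrite in_itv/= -z0 -zJ !(z_le z_lt). Qed.

Lemma Vh_derivable v x : V v -> x \in `[0, L] -> derivable v x 1.
Proof. by move=> [[dv _] _]; exact: dv. Qed.

(** The formula for the first derivative holds at the nodes too, by one-sided
    differentiation, as needed for the continuity of [derive1 v]. *)
Lemma Vh_piece v j : V v -> (j < J)%N -> exists q : 'I_3 -> {poly R},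
  [/\ forall i, (size (q i) <= 4)%N,
      {in `[z j, z j.+1], v =1 poly_curve q},
      {in `[z j, z j.+1], derive1 v =1 poly_curve (fun i => (q i)^`())} &
      {in `]z j, z j.+1[, D2 v =1 poly_curve (fun i => (q i)^`()^`())}].
Proof.
move=> Vv jJ; have [_ pieces] := Vv.
have /choice[q qP] : forall i : 'I_3, exists p : {poly R}, (size p <= 4)%N /\
    forall x, x \in `[z j, z j.+1] -> v x 0 i = p.[x].
  by move=> i; have [p ? ?] := pieces j jJ i; exists p.
have vq : {in `[z j, z j.+1], v =1 poly_curve q}.
  by move=> x xj; apply/rowP => i; rewrite mxE; case: (qP i) => _; exact.
exists q; split=> //.
- by move=> i; case: (qP i).
- move=> x xj; have dv := Vh_derivable Vv (piece_sub jJ xj).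
  apply/rowP => i; rewrite derive1_coord// mxE derivE.
  apply: eq_derive1_segment (z_lt jJ) _ xj (derivable_coord dv) _.
    by move=> y yj; case: (qP i) => _; exact.
  exact: derivable_horner.
- by apply: D2_eq_poly => x xj; apply: vq; exact: subset_itv_oo_cc.
Qed.

Lemma Vh_pw_primitive v i : V v ->
  pw_primitive J z (component v i) (component (derive1 v) i) /\
  pw_primitive J z (component (derive1 v) i) (component (D2 v) i).
Proof.
move=> Vv; split=> j jJ; have [q [_ q0 q1 q2]] := Vh_piece Vv jJ.
  exists (q i); split=> x xj; first by rewrite /component q0// mxE.
  by rewrite /component q1 ?mxE//; exact: subset_itv_oo_cc.
by exists (q i)^`(); split=> x xj; rewrite /component ?q1 ?q2 ?mxE.
Qed.

Lemma Vh_H2_with v : V v -> H2_with L v (derive1 v) (D2 v).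
Proof.
move=> Vv i; have [p1 p2] := Vh_pw_primitive i Vv.
have [c0 _] := pw_primitive_continuous p1.
have [c1 c2] := pw_primitive_continuous p2.
have w1 := pw_primitive_weak z_lt z0 p1.
have w2 := weak_derivative_comp w1 (pw_primitive_weak z_lt z0 p2).
rewrite -zJ; split; first exact: pw_square_integrable.
- by split=> //; exact: pw_square_integrable.
- by split=> //; exact: pw_square_integrable.
Qed.

Lemma derive1ZD c v w x : V v -> V w -> x \in `[0, L] ->
  derive1 (c *: v + w) x = c *: derive1 v x + derive1 w x.
Proof.
move=> Vv Vw xL; have dv := Vh_derivable Vv xL; have dw := Vh_derivable Vw xL.
have dcv : derivable (c *: v) x 1 by exact: derivableZ.
by rewrite [LHS]derive1E (deriveD dcv dw) (deriveZ _ dv) -derive1E -derive1E.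
Qed.

Lemma VhZD c v w : V v -> V w -> V (c *: v + w).
Proof.
move=> Vv Vw; split; last first.
  move=> j jJ i; have [q [sq q0 _ _]] := Vh_piece Vv jJ.
  have [r [sr r0 _ _]] := Vh_piece Vw jJ.
  exists (c *: q i + r i) => [|x xj].
    rewrite (leq_trans (size_polyD _ _))// geq_max sr andbT.
    by rewrite (leq_trans (size_scale_leq _ _)).
  by rewrite hornerD hornerZ -[LHS]/((c *: v x + w x) 0 i) !mxE q0// r0// !mxE.
split=> [x xL|].
  by apply: derivableD; [apply: derivableZ|]; exact: Vh_derivable.
apply: (@subspace_eq_continuous _ _ _ (fun x => c *: derive1 v x + derive1 w x)).
  by move=> x /set_mem/= xL; exact/esym/derive1ZD.
have [[_ cv] _] := Vv; have [[_ cw] _] := Vw.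
by move=> x; apply: cvgD; [apply: cvgZr; exact: cv | exact: cw].
Qed.

Lemma Vh0 : V 0.
Proof.
split=> [|j jJ i]; last first.
  by exists 0 => [|x _]; rewrite ?size_poly0// horner0 mxE.
split=> [x _|]; first exact: derivable_cst.
have -> : derive1 (0 : curve R) = cst 0.
  by apply/funext => x; rewrite derive1_cst.
by move=> x; exact: cvg_cst.
Qed.

Lemma D2ZD c v w j : V v -> V w -> (j < J)%N ->
  {in `]z j, z j.+1[, forall x, D2 (c *: v + w) x = c *: D2 v x + D2 w x}.
Proof.
move=> Vv Vw jJ x xj.
have [q [_ q0 _ q2]] := Vh_piece Vv jJ; have [r [_ r0 _ r2]] := Vh_piece Vw jJ.
rewrite (@D2_eq_poly _ _ (fun i => c *: q i + r i) (z j) (z j.+1))//.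
  rewrite q2// r2//; apply/rowP => i.
  by rewrite !mxE derivD derivZ derivD derivZ hornerD hornerZ.
move=> y yj; rewrite poly_curveZD -q0 -?r0//; exact: subset_itv_oo_cc.
Qed.

Lemma eq_on_derive1 v w x : V v -> V w -> eq_on L v w -> x \in `[0, L] ->
  derive1 v x = derive1 w x.
Proof.
move=> Vv Vw vw xL; apply/rowP => i.
have dv := Vh_derivable Vv xL; have dw := Vh_derivable Vw xL.
rewrite !derive1_coord//.
apply: eq_derive1_segment L_gt0 _ xL (derivable_coord dv) (derivable_coord dw).
by move=> y yL; rewrite vw.
Qed.


Local Notation bend := (bend L).

Lemma bendE v w : bend v w =
  \int[@lebesgue_measure R]_(x in `]z 0%N, z J[) dot (D2 v x) (D2 w x).
Proof. by rewrite z0 zJ bend_L2_prod. Qed.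

Lemma dot_D2_pw v w : V v -> V w ->
  pw_continuous J z (fun x => dot (D2 v x) (D2 w x)).
Proof.
move=> Vv Vw; apply: pw_continuous_sum => i; apply: pw_continuousM.
- by have [_ /pw_primitive_continuous[]] := Vh_pw_primitive i Vv.
- by have [_ /pw_primitive_continuous[]] := Vh_pw_primitive i Vw.
Qed.

Lemma bendC v w : bend v w = bend w v.
Proof.
by rewrite !bend_L2_prod /L2_prod; apply: eq_Rintegral => x _; exact: dotC.
Qed.

Lemma bend_ge0 v : 0 <= bend v v.
Proof.
by rewrite bend_L2_prod; apply: Rintegral_ge0 => x _; exact: dot_ge0.
Qed.

Lemma bendingE v : bending L v = 2^-1 * bend v v.
Proof.
by rewrite /bending /L2_norm -bend_L2_prod sqr_sqrtr//; exact: bend_ge0.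
Qed.

Lemma bendZD c u v w : V u -> V v -> V w ->
  bend (c *: u + v) w = c * bend u w + bend v w.
Proof.
move=> Vu Vv Vw; have Vuv := VhZD c Vu Vv.
have puw := pw_integrable z_lt (dot_D2_pw Vu Vw).
have pvw := pw_integrable z_lt (dot_D2_pw Vv Vw).
rewrite !bendE.
transitivity (\int[@lebesgue_measure R]_(x in `]z 0%N, z J[)
    (c * dot (D2 u x) (D2 w x) + dot (D2 v x) (D2 w x))).
  apply: (pw_eq_integral z_lt (dot_D2_pw Vuv Vw)) => j jJ x xj.
  by rewrite (D2ZD _ Vu Vv jJ)// dotZD.
rewrite RintegralD//; last first.
  apply: (pw_integrable z_lt); apply: pw_continuousM; last exact: dot_D2_pw.
  by apply: continuous_pw => x; exact: cvg_cst.
apply: (congr1 (+%R^~ _)).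
have mD : measurable (`]z 0%N, z J[ : set (measurableTypeR R)).
  exact: measurable_itv.
exact: (RintegralZl c mD puw).
Qed.

Lemma eq_on_bend0 v : V v -> eq_on L v 0 -> bend v v = 0.
Proof.
move=> Vv v0; rewrite bendE.
rewrite (pw_eq_integral (g := fun=> 0) z_lt (dot_D2_pw Vv Vv)).
  by rewrite Rintegral_cst ?mul0r.
move=> j jJ x xj; rewrite (@D2_eq_poly _ v (fun=> 0) (z j) (z j.+1))//.
  rewrite (_ : poly_curve _ x = 0) ?dot0l//.
  by apply/rowP => i; rewrite !mxE !deriv0 horner0.
move=> y yj; rewrite v0; last by apply: (piece_sub jJ); exact: subset_itv_oo_cc.
by apply/rowP => i; rewrite !mxE horner0.
Qed.

Definition sample_point (j : nat) (k : 'I_4) : R :=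
  z j + k%:R / 3 * (z j.+1 - z j).

(** Evaluations rather than Hermite data: they are linear on all curves. *)
Definition sample (s : 'I_J * 'I_4 * 'I_3) v : R :=
  v (sample_point s.1.1 s.1.2) 0 s.2.

Lemma sampleZD s c v w : sample s (c *: v + w) = c * sample s v + sample s w.
Proof. by rewrite /sample -[LHS]/((c *: v _ + w _) 0 _) !mxE. Qed.

(** A polynomial of degree at most 3 with four zeros vanishes. *)
Lemma sample_null v : V v -> (forall s, sample s v = 0) -> eq_on L v 0.
Proof.
move=> Vv s0 x /piece_exists[j jJ xj].
have [q [sq q0 _ _]] := Vh_piece Vv jJ; have jlt := z_lt jJ.
have point_in k : sample_point j k \in `[z j, z j.+1].
  rewrite in_itv/= /sample_point.
  have k0 : 0 <= k%:R / 3 :> R by rewrite divr_ge0.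
  have k1 : k%:R / 3 <= 1 :> R.
    by rewrite ler_pdivrMr// mul1r ler_nat -ltnS ltn_ord.
  by apply/andP; split; nra.
rewrite q0//; apply/rowP => i; rewrite !mxE.
suff -> : q i = 0 by rewrite horner0.
apply: (@roots_geq_poly_eq0 _ _ [seq sample_point j k | k : 'I_4]).
- apply/allP => _ /mapP[k _ ->]; apply/rootP.
  by have := s0 (Ordinal jJ, k, i); rewrite /sample/= q0// mxE.
- rewrite map_inj_uniq ?enum_uniq// => k l kl; apply/val_inj/eqP.
  rewrite -(eqr_nat R); apply/eqP.
  have d0 : z j.+1 - z j != 0 by rewrite subr_eq0 gt_eqF.
  by move: kl => /addrI/(mulIf d0) /(congr1 ( *%R^~ 3)); rewrite !divfK ?pnatr_eq0.
- by rewrite size_map size_enum_ord.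
Qed.

(** A nonzero polynomial has finitely many roots, so if it vanished almost
    everywhere on a subinterval, that interval would be negligible. *)
Lemma ae_eq_on v : V v ->
  {ae @lebesgue_measure R, forall x, x \in `]0, L[ -> v x = 0} -> eq_on L v 0.
Proof.
move=> Vv v0 x /piece_exists[j jJ xj].
have [q [_ q0 _ _]] := Vh_piece Vv jJ; have jlt := z_lt jJ.
rewrite q0//; apply/rowP => i; rewrite !mxE.
suff -> : q i = 0 by rewrite horner0.
apply/eqP/negPn/negP => qi0.
pose N := ~` [set y | y \in `]0, L[ -> v y = 0].
have N0 : lebesgue_measure.-negligible N by exact: v0.
pose Z := [set y | root (q i) y].
have Zfin : finite_set Z.
  apply: contrapT => /(infinite_set_fset (size (q i)))[B BZ].
  rewrite leqNgt => /negP; apply; apply: max_poly_roots qi0 _ (finmap.fset_uniq B).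
  by apply/allP => y yB; exact: (BZ y yB).
have Z0 : lebesgue_measure.-negligible Z.
  apply/negligibleP; last exact/countable_lebesgue_measure0/finite_set_countable.
  by apply: countable_measurable; [exact: measurable_set1 | exact: finite_set_countable].
have sub : `]z j, z j.+1[ `<=` N `|` Z.
  move=> y /= yj; have [ry|ry] := boolP (root (q i) y); [by right | left].
  move=> /= vy0; move/negP: ry; apply; apply/rootP.
  have yL : y \in `]0, L[.
    move: yj; rewrite !in_itv/= -z0 -zJ => /andP[zy yz].
    rewrite (le_lt_trans _ zy) ?(z_le z_lt)//=; last exact: ltnW.
    by rewrite (lt_le_trans yz)// (z_le z_lt).
  have := vy0 yL; rewrite q0; last exact: subset_itv_oo_cc.
  by move/rowP/(_ i); rewrite !mxE.
have NZ0 : lebesgue_measure.-negligible (N `|` Z) by exact: negligibleU.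
have /measure_negligible : lebesgue_measure.-negligible (`]z j, z j.+1[%classic : set R).
  by case: NZ0 => M [mM M0 NZM]; exists M; split=> //; exact: subset_trans sub NZM.
have len : lebesgue_measure (`]z j, z j.+1[%classic : set R) = (z j.+1 - z j)%:E.
  by rewrite lebesgue_measure_itv/= lte_fin jlt -EFinD.
move=> /(_ (measurable_itv _)) m0; have := etrans (esym len) m0.
by move=> /eqP; rewrite eqe subr_eq0 gt_eqF.
Qed.

End SplineSpace.

(** * The discrete curvature flow *)

Section CurvatureFlow.
Variables (R : realType) (L : R) (J : nat) (z : nat -> R).
Variables (Phi : 'rV[R]_3 -> R^o).
Variables (ell : nat) (Lbc : curve R -> 'rV[R]_ell).
Variable ip : curve R -> curve R -> R.
Hypothesis L_gt0 : 0 < L.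
Hypothesis hz : is_partition L J z.
Hypothesis hLbc : bounded_linear_H2 L Lbc.
Hypothesis hker : D2_norm_on_kernel L Lbc.
Hypothesis hip : inner_product_Vh L J z ip.
Implicit Types u v w : curve R.

Local Notation V := (Vh L J z).
Local Notation F := (Fh L J z Phi Lbc).
Local Notation bend := (bend L).

Lemma LbcZD c v w : V v -> V w -> Lbc (c *: v + w) = c *: Lbc v + Lbc w.
Proof.
move=> Vv Vw; have [lin _] := hLbc.
by apply: lin; do 2 eexists; apply: (Vh_H2_with hz); eassumption.
Qed.

Lemma Lbc0 : Lbc 0 = 0.
Proof.
have := LbcZD 1 (Vh0 L J z) (Vh0 L J z).
by rewrite !scale1r addr0 => /eqP; rewrite -subr_eq subrr eq_sym => /eqP.
Qed.

Lemma ker_definite v : V v -> Lbc v = 0 -> bend v v = 0 -> eq_on L v 0.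
Proof.
move=> Vv Bv v0; apply: (ae_eq_on L_gt0 hz Vv).
apply: (hker (Vh_H2_with hz Vv) Bv).
by rewrite /L2_norm -bend_L2_prod v0 sqrtr0.
Qed.

Lemma Fh_Vh u v : F u v -> V v. Proof. by case. Qed.

Lemma Fh0 u : F u 0.
Proof.
split; [exact: Vh0 | | | exact: Lbc0] => j jJ.
  by rewrite dotC dot0l.
by rewrite dotC derive1_cst dot0l.
Qed.

Lemma FhZD u c v w : F u v -> F u w -> F u (c *: v + w).
Proof.
move=> [Vv v1 v2 v3] [Vw w1 w2 w3]; split.
- exact: VhZD.
- by move=> j jJ; rewrite dotC dotZD dotC v1// dotC w1// mulr0 addr0.
- move=> j jJ; rewrite (derive1ZD _ Vv Vw); last exact: (node_in hz).
  by rewrite dotC dotZD dotC v2// dotC w2// mulr0 addr0.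
- by rewrite LbcZD// v3 w3 scaler0 addr0.
Qed.

(** The constraints only see nodal values and derivatives of [u]. *)
Lemma Fh_eq_on u u' v : V u -> V u' -> eq_on L u u' -> F u v -> F u' v.
Proof.
move=> Vu Vu' uu' [Vv v1 v2 v3]; split=> // j jJ; have zj := node_in hz jJ.
  by rewrite -uu'// v1.
by rewrite -(eq_on_derive1 L_gt0 Vu Vu')// v2.
Qed.

Lemma ipZD c u v w : V u -> V v -> V w -> ip (c *: u + v) w = c * ip u w + ip v w.
Proof. by case: hip => + _ _ _; exact. Qed.

Lemma ipC u v : V u -> V v -> ip u v = ip v u.
Proof. by case: hip => _ + _ _; exact. Qed.

Lemma ip_ge0 v : V v -> 0 <= ip v v.
Proof. by case: hip => _ _ + _; exact. Qed.

Lemma ip_eq0 v : V v -> (ip v v = 0 <-> eq_on L v 0).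
Proof. by case: hip => _ _ _; exact. Qed.

Lemma bend_null u v : V u -> V v -> bend v v = 0 -> bend u v = 0.
Proof.
move=> Vu Vv v0.
have := form_CauchySchwarz (fun c x y Vx Vy => VhZD hz c Vx Vy)
  (fun c x y w Vx Vy Vw => bendZD hz c Vx Vy Vw)
  (fun x y _ _ => bendC L x y) (fun x _ => bend_ge0 L x) Vu Vv.
rewrite v0 mulr0 => uv0; apply/eqP; rewrite -sqrf_eq0 eq_le uv0.
exact: sqr_ge0.
Qed.

(** With [v] ranging over [Fh u], the step reads [a d v = - bend u v] for the
    definite form [a = ip + tau * bend]. *)
Lemma flow_step tau u : 0 < tau -> V u -> exists2 d, F u d &
  forall v, F u v -> ip d v + bend (u + tau *: d) v = 0.
Proof.
move=> tau0 Vu.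
pose a v w := ip v w + tau * bend v w.
have aZD c v w x : F u v -> F u w -> F u x ->
    a (c *: v + w) x = c * a v x + a w x.
  move=> /Fh_Vh Vv /Fh_Vh Vw /Fh_Vh Vx; rewrite /a (ipZD c Vv Vw Vx).
  rewrite (bendZD hz c Vv Vw Vx).
  ring.
have aC v w : F u v -> F u w -> a v w = a w v.
  by move=> /Fh_Vh Vv /Fh_Vh Vw; rewrite /a (ipC Vv Vw) (bendC L v w).
have a_ge0 v : F u v -> 0 <= a v v.
  move=> /Fh_Vh Vv; rewrite addr_ge0 ?ip_ge0// mulr_ge0 ?bend_ge0//.
  exact: ltW.
have a_null v : F u v -> (forall s, @sample R J z s v = 0) -> a v v = 0.
  move=> /Fh_Vh Vv /(sample_null L_gt0 hz Vv) v0.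
  by rewrite /a (ip_eq0 Vv).2// (eq_on_bend0 hz)// mulr0 addr0.
have lZD c v w : F u v -> F u w ->
    - bend u (c *: v + w) = c * - bend u v - bend u w.
  move=> /Fh_Vh Vv /Fh_Vh Vw.
  rewrite !(bendC L u) (bendZD hz c Vv Vw Vu); ring.
have l_null v : F u v -> a v v = 0 -> - bend u v = 0.
  move=> /Fh_Vh Vv av0; rewrite bend_null ?oppr0//.
  have := ip_ge0 Vv; have := bend_ge0 L v; move: av0; rewrite /a; nra.
have [d Fd dE] := form_Riesz (Fh0 u) (@FhZD u) aZD aC a_ge0
  (fun s c v w _ _ => sampleZD z s c v w) a_null (l := fun v => - bend u v)
  lZD l_null.
exists d => // v Fv; have Vv := Fh_Vh Fv; have Vd := Fh_Vh Fd.
have := dE v Fv; rewrite /a [u + _]addrC (bendZD hz tau Vd Vu Vv); lra.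
Qed.

(** Twice [tau] times the step tested with [d], by the identity
    [2 B w (w - u) = B w w - B u u + B (w - u) (w - u)] for [w = u + tau d]. *)
Lemma step_energy tau u d : V u -> F u d ->
  ip d d + bend (u + tau *: d) d = 0 ->
  bend (u + tau *: d) (u + tau *: d) + 2 * tau * ip d d <= bend u u.
Proof.
move=> Vu /Fh_Vh Vd; rewrite addrC => eqd.
have := bend_ge0 L d; move: eqd.
rewrite [u + _]addrC; have Vw := VhZD hz tau Vd Vu.
rewrite (bendZD hz tau Vd Vu Vd) (bendZD hz tau Vd Vu Vw).
rewrite (bendC L d (_ + _)) (bendC L u (_ + _)).
rewrite (bendZD hz tau Vd Vu Vd) (bendZD hz tau Vd Vu Vu) (bendC L d u).
nra.
Qed.

(** The two instances are [ip] on [Vh] and [bend] on the kernel of [Lbc]: each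
    is definite there modulo equality on [0, L], so it controls nodal
    values. *)
Lemma node_bound (P : curve R -> Prop) (a : curve R -> curve R -> R) :
  P 0 -> (forall c v w, P v -> P w -> P (c *: v + w)) ->
  (forall v, P v -> V v) ->
  (forall c v w x, P v -> P w -> P x -> a (c *: v + w) x = c * a v x + a w x) ->
  (forall v w, P v -> P w -> a v w = a w v) ->
  (forall v, P v -> 0 <= a v v) ->
  (forall v, P v -> (a v v = 0 <-> eq_on L v 0)) ->
  exists2 C, 0 <= C & forall v j, P v -> (j <= J)%N ->
    \sum_i `|v (z j) 0 i| <= C * Num.sqrt (a v v).
Proof.
move=> P0 PZD PV aZD aC a_ge0 a_eq0.
have /choice[C CP] : forall s : 'I_J.+1 * 'I_3, exists C, 0 <= C /\
    forall v, P v -> `|v (z s.1) 0 s.2| <= C * Num.sqrt (a v v).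
  move=> s; have [|||C C0 CP] := @form_bounded R _ P a P0 PZD aZD aC a_ge0 _
    (@sample R J z) (fun s c v w _ _ => sampleZD z s c v w) _
    (fun v => v (z s.1) 0 s.2).
  - move=> v Pv v0; apply/(a_eq0 v Pv)/(sample_null L_gt0 hz) => //.
    exact: PV.
  - move=> c v w _ _; by rewrite -[LHS]/((c *: v _ + w _) 0 _) !mxE.
  - move=> v Pv /(a_eq0 v Pv) -> //; first by rewrite mxE.
    by apply: (node_in hz); rewrite -ltnS.
  by exists C.
exists (\sum_s C s) => [|v j Pv jJ].
  by apply: sumr_ge0 => s _; case: (CP s).
have -> : (\sum_s C s) * Num.sqrt (a v v) =
    \sum_k \sum_i C (k, i) * Num.sqrt (a v v).
  by rewrite pair_bigA mulr_suml; apply: eq_bigr => -[].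
rewrite (bigD1 (inord j : 'I_J.+1))//= -[leLHS]addr0 lerD//.
  apply: ler_sum => i _; case: (CP (inord j, i)) => _ /(_ v Pv) /=.
  by rewrite inordK.
apply: sumr_ge0 => k _; apply: sumr_ge0 => i _.
by rewrite mulr_ge0 ?sqrtr_ge0//; case: (CP (k, i)).
Qed.

Section Trajectory.
Variables (tau : R) (u0 : curve R) (u d : nat -> curve R).
Hypothesis tau_gt0 : 0 < tau.
Hypothesis Vu0 : V u0.
Hypothesis flow : curvature_flow L J z Phi Lbc ip tau u0 u d.

Lemma flow0 : u 0%N = u0. Proof. by case: flow. Qed.
Lemma flow_Fh k : F (u k) (d k.+1). Proof. by case: flow => _ /(_ k)[]. Qed.
Lemma flow_dVh k : V (d k.+1). Proof. exact: Fh_Vh (flow_Fh k). Qed.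
Lemma flowS k : u k.+1 = u k + tau *: d k.+1.
Proof. by case: flow => _ /(_ k)[]. Qed.

Lemma flow_Vh k : V (u k).
Proof.
elim: k => [|k IH]; first by rewrite flow0.
by rewrite flowS addrC; apply: VhZD => //; exact: flow_dVh.
Qed.

Lemma flow_Lbc k : Lbc (u k) = Lbc u0.
Proof.
elim: k => [|k IH]; first by rewrite flow0.
rewrite flowS addrC LbcZD ?IH; [|exact: flow_dVh|exact: flow_Vh].
by have [_ _ _ ->] := flow_Fh k; rewrite scaler0 add0r.
Qed.

Lemma flow_energy K :
  bend (u K) (u K) + 2 * tau * \sum_(1 <= k < K.+1) ip_norm ip (d k) ^+ 2
    <= bend u0 u0.
Proof.
elim: K => [|K IH].
  by rewrite flow0 big_geq// mulr0 addr0.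
rewrite big_nat_recr//= mulrDr; have [_ /(_ K)[Fd dE _]] := flow.
have := dE _ Fd; rewrite -bend_L2_prod => /(step_energy (flow_Vh K) Fd).
rewrite -flowS sqr_sqrtr; first lra.
exact: ip_ge0 (flow_dVh K).
Qed.

Lemma flow_sum_ip K : 
  tau * \sum_(1 <= k < K.+1) ip (d k) (d k) <= bending L u0.
Proof.
have := flow_energy K; rewrite bendingE.
rewrite (eq_big_nat _ _ (F2 := fun k => ip (d k) (d k))) => [|k /andP[k1 _]].
  by have := bend_ge0 L (u K); lra.
by rewrite sqr_sqrtr//; case: k k1 => // k _; exact: (ip_ge0 (flow_dVh k)).
Qed.

(** Pythagoras at each step: the increment is orthogonal to the old
    derivative at the nodes. *)
Lemma flow_node_derive1 K j : (j <= J)%N ->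
  enorm (derive1 (u K) (z j)) ^+ 2 = enorm (derive1 u0 (z j)) ^+ 2 +
    tau ^+ 2 * \sum_(1 <= k < K.+1) enorm (derive1 (d k) (z j)) ^+ 2.
Proof.
move=> jJ; elim: K => [|K IH]; first by rewrite flow0 big_geq// mulr0 addr0.
rewrite big_nat_recr//= mulrDr addrA -IH -sqr_enormZ_orth; last first.
  by have [_ _ /(_ _ jJ)] := flow_Fh K.
rewrite flowS addrC (derive1ZD _ (flow_dVh K) (flow_Vh K)) 1?addrC//.
exact: (node_in hz).
Qed.

(** The first-order term of the Taylor expansion vanishes, since [d] is tangent
    to the level set of [Phi]; the segment from the old to the new nodal value
    stays in the ball of radius [M] by convexity. *)
Lemma flow_node_value (M B C : R) K j : C2 Phi -> (j <= J)%N -> 0 <= B ->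
  (forall k, \sum_i `|u k (z j) 0 i| <= M) ->
  (forall s, enorm s <= M -> frobenius (hessian Phi s) <= B) ->
  (forall v, V v -> \sum_i `|v (z j) 0 i| <= C * Num.sqrt (ip v v)) ->
  Phi (u0 (z j)) = 0 ->
  `|Phi (u K (z j))| <=
    B * C ^+ 2 * tau ^+ 2 * \sum_(1 <= k < K.+1) ip (d k) (d k).
Proof.
move=> C2Phi jJ B0 uM hB hC Phi0; elim: K => [|K IH].
  by rewrite flow0 Phi0 normr0 big_geq// mulr0.
rewrite big_nat_recr//= mulrDr; set S := _ * \sum_(_ <= _ < _) _ in IH *.
have Vd := flow_dVh K; have [_ grad0 _ _] := flow_Fh K.
have uE : u K.+1 (z j) = u K (z j) + tau *: d K.+1 (z j) by rewrite flowS.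
have grad_h : dot (gradient Phi (u K (z j))) (tau *: d K.+1 (z j)) = 0.
  by rewrite dotC -[_ *: _]addr0 dotZD dot0l dotC grad0// mulr0 addr0.
have step : `|Phi (u K.+1 (z j)) - Phi (u K (z j))| <=
    B * (\sum_i `|(tau *: d K.+1 (z j)) 0 i|) ^+ 2.
  rewrite uE (_ : Phi _ - _ = Phi (u K (z j) + tau *: d K.+1 (z j)) - Phi (u K (z j))
    - dot (gradient Phi (u K (z j))) (tau *: d K.+1 (z j))); last first.
    by rewrite grad_h subr0.
  apply: Taylor1_bound => // s.
  rewrite in_itv/= => /andP[s0 s1]; apply: hB.
  apply: le_trans (enorm_le_sum _) _.
  have -> : u K (z j) + s *: (tau *: d K.+1 (z j)) =
      (1 - s) *: u K (z j) + s *: u K.+1 (z j).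
    by rewrite uE scalerDr scalerBl scale1r addrA subrK.
  apply: (@le_trans _ _ ((1 - s) * \sum_i `|u K (z j) 0 i| +
      s * \sum_i `|u K.+1 (z j) 0 i|)); last first.
    have := uM K; have := uM K.+1; nra.
  rewrite !mulr_sumr -big_split/=; apply: ler_sum => i _.
  rewrite !mxE (le_trans (ler_normD _ _))// !normrM (ger0_norm s0) ger0_norm//.
  by rewrite subr_ge0.
have hsum : (\sum_i `|(tau *: d K.+1 (z j)) 0 i|) ^+ 2 <=
    C ^+ 2 * tau ^+ 2 * ip (d K.+1) (d K.+1).
  have -> : \sum_i `|(tau *: d K.+1 (z j)) 0 i| = tau * \sum_i `|d K.+1 (z j) 0 i|.
    by rewrite mulr_sumr; apply: eq_bigr => i _; rewrite mxE normrM (gtr0_norm tau_gt0).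
  rewrite exprMn [leLHS]mulrC [leRHS]mulrAC ler_wpM2r ?sqr_ge0//.
  rewrite -[X in _ * X]sqr_sqrtr ?(ip_ge0 Vd)// -exprMn.
  rewrite lerXn2r ?nnegrE ?sumr_ge0// ?hC//.
  by apply: (le_trans _ (hC _ Vd)); exact: sumr_ge0.
rewrite -[Phi _](subrK (Phi (u K (z j)))) (le_trans (ler_normD _ _))// addrC lerD//.
apply: le_trans step _; rewrite -2![leRHS]mulrA ler_wpM2l// mulrA.
exact: hsum.
Qed.

End Trajectory.

(** Since the two trajectories agree only on [0, L], the admissible spaces have
    to be identified first; then the difference of the two increments is an
    admissible test function for both equations. *)
Lemma flow_unique tau u0 (u d u' d' : nat -> curve R) : 0 < tau -> V u0 ->
  curvature_flow L J z Phi Lbc ip tau u0 u d ->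
  curvature_flow L J z Phi Lbc ip tau u0 u' d' ->
  forall k, eq_on L (u k) (u' k) /\ eq_on L (d k.+1) (d' k.+1).
Proof.
move=> tau0 Vu0 fl fl'.
have stepE k : eq_on L (u k) (u' k) -> eq_on L (d k.+1) (d' k.+1).
  move=> uu'; have Vu := flow_Vh Vu0 fl k; have Vu' := flow_Vh Vu0 fl' k.
  have Fd := flow_Fh fl k; have Fd' := flow_Fh fl' k.
  have Vd := Fh_Vh Fd; have Vd' := Fh_Vh Fd'.
  have u'u : eq_on L (u' k) (u k) by move=> x xL; rewrite uu'.
  pose e := (-1) *: d' k.+1 + d k.+1; pose w := (-1) *: u' k + u k.
  have Fe : F (u k) e := FhZD _ (Fh_eq_on Vu' Vu u'u Fd') Fd.
  have Fe' : F (u' k) e := Fh_eq_on Vu Vu' uu' Fe.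
  have Ve := Fh_Vh Fe.
  have Vw : V w := VhZD hz _ Vu' Vu.
  have w0 : eq_on L w 0.
    by move=> x xL; rewrite -[LHS]/((-1) *: u' k x + u k x) uu'// scaleN1r addNr.
  have bw : bend w e = 0.
    by rewrite bendC bend_null//; exact: (eq_on_bend0 hz).
  have eqd : ip (d k.+1) e + (tau * bend (d k.+1) e + bend (u k) e) = 0.
    rewrite -(bendZD hz tau Vd Vu Ve) addrC bend_L2_prod addrC.
    by rewrite [_ *: _ + _]addrC; case: fl => _ /(_ k)[_ + _]; exact.
  have eqd' : ip (d' k.+1) e + (tau * bend (d' k.+1) e + bend (u' k) e) = 0.
    rewrite -(bendZD hz tau Vd' Vu' Ve) addrC bend_L2_prod addrC.
    by rewrite [_ *: _ + _]addrC; case: fl' => _ /(_ k)[_ + _]; exact.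
  have ipE : ip e e = -1 * ip (d' k.+1) e + ip (d k.+1) e by exact: ipZD.
  have beE : bend e e = -1 * bend (d' k.+1) e + bend (d k.+1) e by exact: (bendZD hz).
  have bwE : bend w e = -1 * bend (u' k) e + bend (u k) e by exact: (bendZD hz).
  have e0 : eq_on L e 0.
    apply/(ip_eq0 Ve); have := ip_ge0 Ve; have := bend_ge0 L e.
    by rewrite bw in bwE; nra.
  move=> x xL; have := e0 x xL.
  rewrite -[LHS]/((-1) *: d' k.+1 x + d k.+1 x) scaleN1r => /eqP.
  by rewrite addrC subr_eq0 => /eqP.
suff uk k : eq_on L (u k) (u' k) by move=> k; split=> //; exact: stepE.
elim: k => [|k IH]; first by rewrite (flow0 fl) (flow0 fl').
move=> x xL; rewrite (flowS fl) (flowS fl').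
rewrite -[LHS]/(u k x + tau *: d k.+1 x) -[RHS]/(u' k x + tau *: d' k.+1 x).
by rewrite IH// (stepE k IH).
Qed.

(** The step is chosen for every curve, with a dummy value outside [Vh], so that
    the sequence can be defined by plain recursion. *)
Lemma flow_exists tau u0 : 0 < tau -> V u0 ->
  exists (u d : nat -> curve R), curvature_flow L J z Phi Lbc ip tau u0 u d.
Proof.
move=> tau0 Vu0.
have /choice[f fP] : forall v, exists d, V v -> F v d /\
    forall w, F v w -> ip d w + bend (v + tau *: d) w = 0.
  move=> v; have [Vv|nVv] := pselect (V v); last by exists 0.
  by have [d Fd dE] := flow_step tau0 Vv; exists d.
pose u := fix u k := if k is k'.+1 then u k' + tau *: f (u k') else u0.
have Vu k : V (u k).
  elim: k => [|k IH]; first exact: Vu0.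
  have -> : u k.+1 = tau *: f (u k) + u k by exact: addrC.
  by have [Ff _] := fP _ IH; exact: (VhZD hz tau (Fh_Vh Ff) IH).
exists u, (fun k => f (u k.-1)); split=> [//|k]; have [Ff fE] := fP _ (Vu k).
split; [exact: Ff | move=> v Fv | by []].
by rewrite -bend_L2_prod; exact: fE.
Qed.

(** The radius depends on [u0] only: [u k - u0] is in the kernel of [Lbc], and
    its bending energy is at most four times that of [u0] by the parallelogram
    inequality and the energy law. *)
Lemma flow_bounded u0 : V u0 -> exists2 M, 0 <= M &
  forall tau (u d : nat -> curve R), 0 < tau ->
  curvature_flow L J z Phi Lbc ip tau u0 u d ->
  forall k j, (j <= J)%N -> \sum_i `|u k (z j) 0 i| <= M.
Proof.
move=> Vu0; pose P v := V v /\ Lbc v = 0.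
have PZD c v w : P v -> P w -> P (c *: v + w).
  move=> [Vv v0] [Vw w0]; split; first exact: VhZD.
  by rewrite LbcZD// v0 w0 scaler0 addr0.
have [|||||||C C0 CP] := @node_bound P bend.
- by split; [exact: Vh0 | exact: Lbc0].
- exact: PZD.
- by move=> v [].
- by move=> c v w x [Vv _] [Vw _] [Vx _]; exact: (bendZD hz).
- by move=> v w _ _; exact: bendC.
- by move=> v _; exact: bend_ge0.
- by move=> v [Vv v0]; split=> [|v0']; [exact: ker_definite | exact: (eq_on_bend0 hz)].
pose M0 := \sum_(j < J.+1) \sum_i `|u0 (z j) 0 i|.
exists (M0 + C * Num.sqrt (4 * bend u0 u0)).
  by rewrite addr_ge0 ?mulr_ge0 ?sqrtr_ge0// sumr_ge0// => j _; exact: sumr_ge0.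
move=> tau u d tau0 fl k j jJ.
have Vuk := flow_Vh Vu0 fl k; pose w := (-1) *: u0 + u k.
have Vw : V w := VhZD hz _ Vu0 Vuk.
have Pw : P w.
  split; first exact: Vw.
  by rewrite (LbcZD _ Vu0 Vuk) (flow_Lbc Vu0 fl) scaleN1r addNr.
have bw : bend w w <= 4 * bend u0 u0.
  have := flow_energy Vu0 fl k.
  have : 0 <= 2 * tau * \sum_(1 <= i < k.+1) ip_norm ip (d i) ^+ 2.
    by rewrite mulr_ge0 ?mulr_ge0 ?(ltW tau0)// sumr_ge0// => i _; exact: sqr_ge0.
  (* B w w + B s s = 2 (B u_k u_k + B u0 u0) for the difference w and sum s *)
  have := bend_ge0 L (1 *: u0 + u k).
  rewrite /w !(form_sqrZD (P := V) (fun c v w => @VhZD R L J z hz c v w)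
    (fun c u v w => @bendZD R L J z hz c u v w) (fun v w _ _ => bendC L v w))//.
  lra.
rewrite (le_trans (_ : _ <= \sum_i `|u0 (z j) 0 i| + \sum_i `|w (z j) 0 i|))//.
  rewrite -big_split; apply: ler_sum => i _ /=.
  rewrite -[w (z j) 0 i]/(((-1) *: u0 (z j) + u k (z j)) 0 i) !mxE.
  by rewrite (le_trans _ (ler_normD _ _))// mulN1r addNKr.
apply: lerD.
  rewrite /M0 (bigD1 (inord j : 'I_J.+1))//= inordK// lerDl sumr_ge0// => l _.
  exact: sumr_ge0.
apply: le_trans (CP _ _ Pw jJ) _.
by rewrite ler_wpM2l// ler_sqrt// mulr_ge0// bend_ge0.
Qed.

End CurvatureFlow.

(** * Maxima over the nodes *)

Lemma Linf_h_le (R : realType) (J : nat) (z : nat -> R) (f : R -> R) (B : R) :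
  0 <= B -> (forall j, (j <= J)%N -> `|f (z j)| <= B) -> Linf_h J z f <= B.
Proof. by move=> B0 fB; apply: bigmax_le => // j _; apply: fB; rewrite -ltnS. Qed.

Lemma le_Linf_h (R : realType) (J : nat) (z : nat -> R) (f : R -> R) j :
  (j <= J)%N -> `|f (z j)| <= Linf_h J z f.
Proof.
move=> jJ; have -> : j = (inord j : 'I_J.+1) by rewrite inordK.
exact: (le_bigmax _ (fun j : 'I_J.+1 => `|f (z j)|)).
Qed.

(** * Energy law and constraint violation *)

Theorem proposition3p2 (R : realType) (L : R) (hL : 0 < L)
  (Phi : 'rV[R]_3 -> R^o) (hPhi : C1 Phi)
  (ell : nat) (Lbc : curve R -> 'rV[R]_ell) (lbc : 'rV[R]_ell)
  (hLbc : bounded_linear_H2 L Lbc) (hker : D2_norm_on_kernel L Lbc)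
  (J : nat) (z : nat -> R) (hz : is_partition L J z)
  (ip : curve R -> curve R -> R) (hip : inner_product_Vh L J z ip)
  (u0 : curve R) (hu0 : Ah L J z Phi Lbc lbc u0) :
  (* (i) *)
  (forall tau : R, 0 < tau ->
     [/\ exists u d, curvature_flow L J z Phi Lbc ip tau u0 u d,
         forall u d u' d',
           curvature_flow L J z Phi Lbc ip tau u0 u d ->
           curvature_flow L J z Phi Lbc ip tau u0 u' d' ->
           forall k, eq_on L (u k) (u' k) /\ eq_on L (d k.+1) (d' k.+1) &
         forall u d, curvature_flow L J z Phi Lbc ip tau u0 u d ->
           forall K : nat,
             Vh L J z (u K) /\
             bending L (u K) + tau * \sum_(1 <= k < K.+1) ip_norm ip (d k) ^+ 2
               <= bending L u0]) /\
  (* (ii) *)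
  (forall cstar cS2 r : R,
     C2 Phi -> 0 < cstar -> 0 < cS2 -> 0 <= r ->
     (forall v, Vh L J z v ->
        Linf_h J z (fun x => enorm (derive1 v x)) ^+ 2
          <= cstar * ip_norm ip v ^+ 2) ->
     (forall s : 'rV[R]_3,
        frobenius (hessian Phi s) <= cS2 * (1 + enorm s `^ r)) ->
     exists2 c' : R, 0 < c' &
       forall tau : R, 0 < tau ->
       forall u d, curvature_flow L J z Phi Lbc ip tau u0 u d ->
       forall K : nat,
         \big[Num.max/0]_(k < K.+1)
           Linf_h J z (fun x => enorm (derive1 (u k) x) ^+ 2 - 1)
           <= cstar * tau * bending L u0 /\
         \big[Num.max/0]_(k < K.+1) Linf_h J z (fun x => Phi (u k x))
           <= cstar * cS2 * c' * tau * bending L u0 `^ (r + 1)).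
Proof.
have [Vu0 du0 Phiu0 _] := hu0.
split=> [tau tau_gt0|cstar cS2 r C2Phi cstar_gt0 cS2_gt0 r_ge0 node_norm growth].
  split; first exact: (flow_exists Phi hL hz hLbc hip).
    by move=> u d u' d'; exact: (flow_unique hL hz hLbc hip).
  move=> u d fl K; split; first exact: (flow_Vh hz Vu0 fl).
  have := flow_energy hz hip Vu0 fl K; rewrite !bendingE; lra.
have [M M_ge0 hM] := flow_bounded Phi hL hz hLbc hker hip Vu0.
have [||||||C C_ge0 hC] := @node_bound R L J z hL hz (Vh L J z) ip (Vh0 L J z).
- by move=> c v w; exact: VhZD.
- by [].
- by move=> c v w x; exact: (ipZD hip).
- by move=> v w; exact: (ipC hip).
- by move=> v; exact: (ip_ge0 hip).
- by move=> v; exact: (ip_eq0 hip).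
set e0 := bending L u0; pose B := 1 + M `^ r.
have e0_ge0 : 0 <= e0 by rewrite /e0 bendingE mulr_ge0// bend_ge0.
have B_ge0 : 0 <= B by rewrite addr_ge0// powR_ge0.
have hess s : enorm s <= M -> frobenius (hessian Phi s) <= cS2 * B.
  move=> sM; apply: le_trans (growth s) _; rewrite ler_wpM2l ?(ltW cS2_gt0)//.
  by rewrite lerD2l ge0_ler_powR// nnegrE// enorm_ge0.
have q_ge0 : 0 <= B * C ^+ 2 / (cstar * e0 `^ r).
  by rewrite mulr_ge0 ?invr_ge0 ?mulr_ge0 ?sqr_ge0 ?powR_ge0// ltW.
(* The division by e0 `^ r adjusts the constant to the factor e0 `^ (r + 1); the
   estimate reads 0 <= 0 when e0 = 0. The 1 keeps the constant positive. *)
exists (1 + B * C ^+ 2 / (cstar * e0 `^ r)); first by rewrite ltr_pwDl.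
move=> tau tau_gt0 u d fl K.
have sum_le k : tau * \sum_(1 <= l < k.+1) ip (d l) (d l) <= e0.
  exact: (flow_sum_ip hz hip Vu0 fl).
clearbody e0; split.
  have bnd_ge0 : 0 <= cstar * tau * e0.
    by rewrite !mulr_ge0 ?(ltW cstar_gt0) ?(ltW tau_gt0).
  apply: bigmax_le => // k _; apply: Linf_h_le => // j jJ.
  rewrite (flow_node_derive1 hz Vu0 fl _ jJ) du0// expr1n addrC addKr.
  set S := \sum_(_ <= _ < _) _.
  have S_ge0 : 0 <= S by apply: sumr_ge0 => l _; exact: sqr_ge0.
  have S_le : S <= cstar * \sum_(1 <= l < k.+1) ip (d l) (d l).
    rewrite mulr_sumr; apply: ler_sum_nat => -[//|l] _.
    have Vd := flow_dVh fl l; have := node_norm _ Vd.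
    rewrite [ip_norm _ _ ^+ 2]sqr_sqrtr ?(ip_ge0 hip Vd)//; apply: le_trans.
    have := le_Linf_h z (fun x => enorm (derive1 (d l.+1) x)) jJ.
    rewrite ger0_norm ?enorm_ge0// => dle.
    by rewrite lerXn2r// nnegrE ?(le_trans _ dle) ?enorm_ge0.
  rewrite (ger0_norm (mulr_ge0 (sqr_ge0 tau) S_ge0)).
  apply: le_trans (ler_wpM2l (sqr_ge0 tau) S_le) _.
  set Q := \sum_(_ <= _ < _) _.
  have -> : tau ^+ 2 * (cstar * Q) = cstar * tau * (tau * Q) by ring.
  by rewrite ler_wpM2l ?sum_le// mulr_ge0 ?(ltW cstar_gt0) ?(ltW tau_gt0).
have rhsE : cstar * cS2 * (1 + B * C ^+ 2 / (cstar * e0 `^ r)) * tau * e0 `^ (r + 1)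
    = cstar * cS2 * tau * e0 `^ (r + 1) + cS2 * B * C ^+ 2 * tau * e0.
  have [e00|e00] := eqVneq e0 0.
    have -> : e0 `^ (r + 1) = 0 by rewrite e00 powR0// gt_eqF// ltr_wpDl.
    by rewrite e00 !mulr0 addr0.
  have e0_gt0 : 0 < e0 by rewrite lt_def e00.
  have er_gt0 : 0 < e0 `^ r by rewrite powR_gt0.
  rewrite powRD ?e00 ?implybT// powRr1//.
  by field; rewrite !gt_eqF.
rewrite rhsE.
have main_ge0 : 0 <= cS2 * B * C ^+ 2 * tau * e0.
  by rewrite !mulr_ge0 ?sqr_ge0 ?(ltW cS2_gt0) ?(ltW tau_gt0).
have extra_ge0 : 0 <= cstar * cS2 * tau * e0 `^ (r + 1).
  by rewrite !mulr_ge0 ?powR_ge0 ?(ltW cstar_gt0) ?(ltW cS2_gt0) ?(ltW tau_gt0).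
apply: bigmax_le => [|k _]; first by rewrite addr_ge0.
apply: Linf_h_le => [|j jJ]; first by rewrite addr_ge0.
have B'_ge0 : 0 <= cS2 * B by rewrite mulr_ge0// ltW.
have uM l : \sum_i `|u l (z j) 0 i| <= M by exact: (hM tau u d).
have hCj v : Vh L J z v -> \sum_i `|v (z j) 0 i| <= C * Num.sqrt (ip v v).
  by move=> Vv; exact: hC.
have := flow_node_value hip tau_gt0 fl k C2Phi jJ B'_ge0 uM hess hCj (Phiu0 j jJ).
move=> /le_trans; apply.
rewrite -[leLHS]add0r lerD//.
have coef_ge0 : 0 <= cS2 * B * C ^+ 2 * tau.
  by rewrite !mulr_ge0 ?sqr_ge0 ?(ltW cS2_gt0) ?(ltW tau_gt0).
by have := ler_wpM2l coef_ge0 (sum_le k); rewrite expr2 !mulrA.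
Qed.
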